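(* Let $D$ be an integral domain with quotient field $K$, let $\star$ be a semistar operation on $D$, and let $n\ge 0$ be an integer. Then the following statements are equivalent (in each of (1), (2), (3), (5), (6), ''$n$ is minimal'' means that $n$ is the least nonnegative integer for which the stated property holds): (1) For every overring $T$ of $D$ and every semistar operation $\star'$ on $T$ such that $T$ is $(\star,\star')$-linked to $D$, one has $\widetilde{\star'}\text{-}\dim(T)\le n$; and $n$ is minimal. (2) Every $(\star,w_T)$-linked overring $T$ of $D$ satisfies $w_T\text{-}\dim(T)\le n$; and $n$ is minimal. (3) Every overring $T$ of $D$ satisfies $\widetilde{\star}_{\iota}\text{-}\dim(T)\le n$, where $\iota:D\to T$ is the canonical inclusion; and $n$ is minimal. (4) $\widetilde{\star}\text{-}\dim_v(D)=n$. (5) For every finite subset $\{t_i\}_{i=1}^n$ of $K$, $\widetilde{\star}_{\iota}\text{-}\dim(D[t_1,\cdots,t_n])\le n$, where $\iota:D\to D[t_1,\cdots,t_n]$ is the canonical inclusion; and $n$ is minimal. (6) For every finite subset $\{t_i\}_{i=1}^n$ of $K$ and every semistar operation $\star'$ on $D[t_1,\cdots,t_n]$ such that $D[t_1,\cdots,t_n]$ is a $(\star,\star')$-linked overring of $D$, $\widetilde{\star'}\text{-}\dim(D[t_1,\cdots,t_n])\le n$; and $n$ is minimal. (7) $\star[X_1,\cdots,X_n]\text{-}\dim(D[X_1,\cdots,X_n])=2n$.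
   Context: For a domain $D$ with quotient field $K$, $\overline{\mathcal F}(D)$ is the set of nonzero $D$-submodules of $K$ and $f(D)$ the set of nonzero finitely generated $D$-submodules of $K$. A semistar operation on $D$ is a map $\star:\overline{\mathcal F}(D)\to\overline{\mathcal F}(D)$, $E\mapsto E^\star$, such that for all $0\ne x\in K$ and $E,F\in\overline{\mathcal F}(D)$: $(xE)^\star=xE^\star$; $E\subseteq F$ implies $E^\star\subseteq F^\star$; $E\subseteq E^\star=(E^\star)^\star$. Define $E^{\star_f}:=\bigcup\{F^\star\mid F\in f(D),F\subseteq E\}$. A nonzero ideal $I$ of $D$ is a quasi-$\star$-ideal if $I^\star\cap D=I$; a quasi-$\star$-prime is a prime quasi-$\star$-ideal; $\operatorname{QMax}^{\star}(D)$ is the set of maximal elements of the set of proper quasi-$\star$-ideals (they are prime). $\widetilde\star$ is the semistar operation $E^{\widetilde\star}:=\bigcap\{ED_P\mid P\in\operatorname{QMax}^{\star_f}(D)\}$ (equal to $K$ if $\operatorname{QMax}^{\star_f}(D)=\emptyset$). $v_D$ is the operation $E^{v_D}:=(D:(D:E))$, where $(D:E)=\{x\in K\mid xE\subseteq D\}$ (with $E^{v_D}=K$ if $(D:E)=0$), and $w_D:=\widetilde{v_D}$. $\star\text{-}\dim(D)$ is the supremum of the integers $n$ such that there is a chain $(0)\subsetneq P_1\subsetneq\cdots\subsetneq P_n$ with each $P_i$ a quasi-$\star$-prime of $D$; it is $0$ if there are no quasi-$\star$-primes. An overring of $D$ is a ring $T$ with $D\subseteq T\subseteq K$. If $\iota:D\to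 T$ is the inclusion, $\star_\iota$ is the semistar operation on $T$ given by $E^{\star_\iota}:=E^\star$ for $E\in\overline{\mathcal F}(T)\subseteq\overline{\mathcal F}(D)$; $\widetilde\star_\iota$ means $(\widetilde\star)_\iota$. For a semistar operation $\star'$ on $T$, $T$ is $(\star,\star')$-linked to $D$ (a $(\star,\star')$-linked overring) if $F^\star=D^\star$ implies $(FT)^{\star'}=T^{\star'}$ for every nonzero finitely generated ideal $F$ of $D$. A valuation overring $V$ of $D$ ($V=K$ allowed, of dimension $0$) is a $\star$-valuation overring if $F^\star\subseteq FV$ for each $F\in f(D)$. $\star\text{-}\dim_v(D)=n$ means every $\star$-valuation overring of $D$ has dimension at most $n$ and some $\star$-valuation overring has dimension $n$; if no such integer exists, $\star\text{-}\dim_v(D)=\infty$. Let $X,Y$ be indeterminates, $D_1:=D[X]$, $K_1:=K(X)$, $\Theta_1^{\star}:=\{Q\in\operatorname{Spec}(D_1)\mid Q\cap D=(0)\text{ or }(Q\cap D)^{\star_f}\subsetneq D^{\star}\}$, $\mathfrak S_1^\star:=D_1[Y]\setminus\bigcup\{Q[Y]\mid Q\in\Theta_1^\star\}$. The semistar operation $\star[X]$ on $D[X]$ is defined by $E^{\star[X]}:=E[Y]_{\mathfrak S_1^\star}\cap K_1$ for $E\in\overline{\mathcal F}(D_1)$. For $r\ge2$, $\star[X_1,\cdots,X_r]:=(\star[X_1,\cdots,X_{r-1}])[X_r]$. For $n=0$, read $D[X_1,\cdots,X_n]$ as $D$ and $\star[X_1,\cdots,X_n]$ as $\widetilde\star$.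 *)

(* Defs.v *)
From mathcomp Require Import all_boot all_order all_algebra.
From mathcomp Require Import all_classical.

Set Implicit Arguments.
Unset Strict Implicit.
Unset Printing Implicit Defensive.

Import Order.TTheory GRing.Theory.
Local Open Scope classical_set_scope.
Local Open Scope ring_scope.

(* A domain, its overrings, modules and ideals are all subsets of one field K,
   the common quotient field of the domain and its overrings.                 *)
Section Domains.
Variable K : fieldType.
Implicit Types (D T V E F I P : set K) (star : set K -> set K).

Definition is_subring D : Prop :=
  [/\ D 1, forall x y, D x -> D y -> D (x - y)
    & forall x y, D x -> D y -> D (x * y)].

Definition is_domain_with_quotient_field D : Prop :=
  is_subring D /\
  forall x : K, exists a b, [/\ D a, D b, b != 0 & x = a / b].

Definition is_overring D T : Prop := is_subring T /\ D `<=` T.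

Definition adjoin D (S : set K) : set K := smallest is_subring (D `|` S).

Definition is_submodule D E : Prop :=
  [/\ E 0, forall x y, E x -> E y -> E (x + y)
    & forall a x, D a -> E x -> E (a * x)].

Definition nonzero_submodules D : set (set K) :=
  [set E | is_submodule D E /\ exists2 x, E x & x != 0].

(* The product E T: finite sums of products. *)
Definition prod_mod E T : set K :=
  [set x | exists n (e t : 'I_n -> K),
     [/\ forall i, E (e i), forall i, T (t i) & x = \sum_(i < n) e i * t i]].

Definition fg_submodules D : set (set K) :=
  [set F | nonzero_submodules D F /\
           exists s : seq K, F = prod_mod [set x | x \in s] D].

Definition is_ideal D I : Prop := is_submodule D I /\ I `<=` D.

Definition is_prime_ideal D P : Prop :=
  [/\ is_ideal D P, ~ P 1
    & forall x y, D x -> D y -> P (x * y) -> P x \/ P y].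

Definition localization D P : set K :=
  [set x | exists a s, [/\ D a, D s, ~ P s & x = a / s]].

Definition colon D E : set K := [set x | forall e, E e -> D (x * e)].

(* A semistar operation on D is given by a total map on subsets of K, of which
   only the values at nonzero D-submodules of K are meaningful: the definitions
   below use no other value.                                                  *)
Definition is_semistar D star : Prop :=
  [/\ forall E, nonzero_submodules D E -> nonzero_submodules D (star E),
      forall x E, x != 0 -> nonzero_submodules D E ->
        star [set x * e | e in E] = [set x * e | e in star E],
      forall E F, nonzero_submodules D E -> nonzero_submodules D F ->
        E `<=` F -> star E `<=` star F
    & forall E, nonzero_submodules D E ->
        E `<=` star E /\ star (star E) = star E].

(* For an overring T of D, nonzero T-submodules of K are nonzero D-submodules,
   so the operation induced on T is given by the same map; T only records the
   ring on which the result is considered.                                    *)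
Definition semistar_restr T star : set K -> set K := fun E => star E.

Definition star_f D star : set K -> set K :=
  fun E => \bigcup_(F in [set F | fg_submodules D F /\ F `<=` E]) star F.

Definition is_quasi_ideal D star I : Prop :=
  [/\ is_ideal D I, nonzero_submodules D I & star I `&` D = I].

Definition is_quasi_prime D star P : Prop :=
  is_quasi_ideal D star P /\ is_prime_ideal D P.

Definition QMax D star : set (set K) :=
  [set M | [/\ is_quasi_ideal D star M, M <> D
    & forall I, is_quasi_ideal D star I -> I <> D -> M `<=` I -> I = M]].

(* The intersection over an empty family is setT, that is, K. *)
Definition tilde D star : set K -> set K :=
  fun E => \bigcap_(P in QMax D (star_f D star)) prod_mod E (localization D P).

(* If (D : E) = 0 then (D : (D : E)) is setT, that is, K. *)
Definition v_op D : set K -> set K := fun E => colon D (colon D E).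

Definition w_op D : set K -> set K := tilde D (v_op D).

Definition star_chain_lengths D star : set nat :=
  [set n | exists P : nat -> set K, P 0%N = [set 0] /\
     forall i, (i < n)%N -> P i `<` P i.+1 /\ is_quasi_prime D star (P i.+1)].

(* The length 0 always occurs, so the dimension is 0 if there is no
   quasi-star-prime; the dimension is infinite if there is no upper bound.    *)
Definition star_dim_le D star (n : nat) : Prop :=
  ubound (star_chain_lengths D star) n.

Definition star_dim_eq D star (n : nat) : Prop :=
  supremums (star_chain_lengths D star) n.

Definition is_linked D star T star' : Prop :=
  forall F, fg_submodules D F -> F `<=` D ->
    star F = star D -> star' (prod_mod F T) = star' T.

Definition is_valuation_overring D V : Prop :=
  is_overring D V /\ forall x, x != 0 -> V x \/ V x^-1.

Definition is_star_valuation_overring D star V : Prop :=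
  is_valuation_overring D V /\
  forall F, fg_submodules D F -> star F `<=` prod_mod F V.

Definition krull_chain_lengths D : set nat :=
  [set n | exists P : nat -> set K,
     (forall i, (i <= n)%N -> is_prime_ideal D (P i)) /\
     (forall i, (i < n)%N -> P i `<` P i.+1)].

Definition krull_dim_le D (n : nat) : Prop := ubound (krull_chain_lengths D) n.

Definition krull_dim_eq D (n : nat) : Prop :=
  supremums (krull_chain_lengths D) n.

Definition star_dimv_eq D star (n : nat) : Prop :=
  (forall V, is_star_valuation_overring D star V -> krull_dim_le V n) /\
  (exists2 V, is_star_valuation_overring D star V & krull_dim_eq V n).

End Domains.

Definition is_least (A : set nat) (n : nat) : Prop :=
  A n /\ forall m, A m -> (n <= m)%N.

(* The set E[X] of polynomials with all coefficients in E. *)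
Definition poly_set (K : fieldType) (E : set K) : set {poly K} :=
  [set p | forall i, E p`_i].

Definition ratfun (K : fieldType) : fieldType := {fraction {poly K}}.

Section PolynomialExtension.
Variable K : fieldType.
Implicit Types (D : set K) (star : set K -> set K).

Definition polyfrac (p : {poly K}) : ratfun K := tofrac p.

Definition poly_ring D : set (ratfun K) := polyfrac @` poly_set D.

Definition contraction D (Q : set (ratfun K)) : set K :=
  [set a | D a /\ Q (polyfrac a%:P)].

Definition Theta1 D star : set (set (ratfun K)) :=
  [set Q | is_prime_ideal (poly_ring D) Q /\
     (contraction D Q = [set 0] \/
      star_f D star (contraction D Q) `<` star D)].

End PolynomialExtension.

Definition S1 (K : fieldType) (D : set K) (star : set K -> set K) :
    set {poly ratfun K} :=
  poly_set (poly_ring D) `\` \bigcup_(Q in Theta1 D star) poly_set Q.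

(* The intersection with K(X) is taken in K(X)(Y). *)
Definition star_poly (K : fieldType) (D : set K) (star : set K -> set K) :
    set (ratfun K) -> set (ratfun K) :=
  fun E => [set x | exists p s,
    [/\ poly_set E p, S1 D star s & polyfrac x%:P = polyfrac p / polyfrac s]].

Fixpoint iter_ratfun (K : fieldType) (n : nat) : fieldType :=
  if n is m.+1 then ratfun (iter_ratfun K m) else K.

Fixpoint iter_poly_ring (K : fieldType) (D : set K) (n : nat) :
    set (iter_ratfun K n) :=
  match n return set (iter_ratfun K n) with
  | 0 => D
  | m.+1 => poly_ring (@iter_poly_ring K D m)
  end.
Arguments iter_poly_ring {K} D n.

Fixpoint iter_star_poly (K : fieldType) (D : set K) (star : set K -> set K)
    (n : nat) : set (iter_ratfun K n) -> set (iter_ratfun K n) :=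
  match n return set (iter_ratfun K n) -> set (iter_ratfun K n) with
  | 0 => star
  | m.+1 => star_poly (iter_poly_ring D m) (@iter_star_poly K D star m)
  end.
Arguments iter_star_poly {K} D star n _.

(* The iteration starts from star, but for n = 0 the operation is the tilde
   operation of star rather than star itself.                                 *)
Definition star_polys (K : fieldType) (D : set K) (star : set K -> set K)
    (n : nat) : set (iter_ratfun K n) -> set (iter_ratfun K n) :=
  match n return set (iter_ratfun K n) -> set (iter_ratfun K n) with
  | 0 => tilde D star
  | m.+1 => iter_star_poly D star m.+1
  end.
Arguments star_polys {K} D star n _.

(* Main.v *)
From HB Require Import structures.
Require Import Defs.
From mathcomp Require Import all_boot all_order all_algebra.
From mathcomp Require Import all_classical.
From mathcomp Require Import ring zify.

(* The ideals of [D] that contain no finitely generated [F] with [1] in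
   [star F] are exactly those contained in some quasi-maximal ideal of [star_f],
   so the quasi-primes involved are nonzero primes whose trace on [D] contains no
   such [F] (all of them, for the semistar operations induced by the tilde of
   [star] and for [star[X_1, ..., X_n]]).  All seven
   conditions then compare [n] with the supremum [d] of the dimensions of the
   valuation overrings of [D] whose centre contains no such [F].

   By Chevalley's theorem a chain of primes of any ring lifts to a chain of
   primes of a valuation ring, whence the bound [d] for all (linked) overrings;
   conversely [m + 1] nonzero primes of a valuation overring stay distinct on
   [D[t_1, ..., t_m]] for suitable [t_i], because the smallest of them already
   meets [D].

   For the polynomial rings, evaluation at such a point [t] pulls a chain of
   length [k <= n + 1] back to one of length [n + k] in [D[X_1, ..., X_n]].  In
   the other direction a chain of length [l] lifts to a valuation ring of
   [K(X_1, ..., X_n)], and restricting a valuation ring from [L(X)] to [L]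
   identifies at most one pair of consecutive primes, since two elements of
   [L(X)] are algebraically dependent over [L]; this leaves a chain of length at
   least [l - n] in a valuation overring of [D].  Hence the dimension is [2n] if
   and only if [d = n]. *)

Set Implicit Arguments.
Unset Strict Implicit.
Unset Printing Implicit Defensive.

Import Order.TTheory GRing.Theory.

(** * Subrings, submodules and localization *)

Section SubringsAndModules.
Local Open Scope classical_set_scope.
Local Open Scope ring_scope.
Variable K : fieldType.
Implicit Types (D T B E F I M P Q : set K).

(** The operations to be compared live on different rings, even in different fields. Everything is
    therefore expressed by one condition, [avoids], which refers to [D] and [star] alone, depends
    only on the trace on [D], and passes to smaller sets; a chain is moved between overrings,
    valuation rings and polynomial rings by watching its largest prime.

    For an arbitrary linked [star'] the quasi-primes of its tilde satisfy this condition, but not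
    conversely. The lower estimates therefore use operations chosen for the purpose: localization at
    the top prime of a chain, or the [w] operation of a valuation ring.

    Value groups do not appear: chains of primes are counted directly, and two elements have equal
    value when their quotient and its inverse both lie in the ring.

    The number [2n] singles out [d = n] because [n] variables lengthen chains by at most [n], while
    every chain of length at most [n + 1] does gain [n]. So [d < n] leaves the dimension below [2n],
    and [d > n] already produces a chain of length [2n + 1]. *)

Lemma subring1 D : is_subring D -> D 1. Proof. by case. Qed.
Lemma subringB D x y : is_subring D -> D x -> D y -> D (x - y).
Proof. by case=> _ + _; apply. Qed.
Lemma subringM D x y : is_subring D -> D x -> D y -> D (x * y).
Proof. by case=> _ _; apply. Qed.
Lemma subring0 D : is_subring D -> D 0.
Proof. by move=> hD; rewrite -(subrr 1); apply: subringB; do ?exact: subring1. Qed.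
Lemma subringN D x : is_subring D -> D x -> D (- x).
Proof. by move=> hD Dx; rewrite -sub0r; apply: subringB => //; apply: subring0. Qed.
Lemma subringD D x y : is_subring D -> D x -> D y -> D (x + y).
Proof.
by move=> hD Dx Dy; rewrite -(opprK y); apply: subringB => //; apply: subringN.
Qed.
Lemma subringX D x n : is_subring D -> D x -> D (x ^+ n).
Proof.
move=> hD Dx; elim: n => [|n IH]; first exact: subring1.
by rewrite exprS; apply: subringM.
Qed.
Lemma subring_sum D (J : Type) (r : seq J) (p : pred J) (f : J -> K) :
  is_subring D -> (forall i, p i -> D (f i)) -> D (\sum_(i <- r | p i) f i).
Proof.
by move=> hD Df; apply: (big_ind D) => // [|x y]; [apply: subring0|apply: subringD].
Qed.

Lemma submod0 D E : is_submodule D E -> E 0. Proof. by case. Qed.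
Lemma submodD D E x y : is_submodule D E -> E x -> E y -> E (x + y).
Proof. by case=> _ + _; apply. Qed.
Lemma submodM D E a x : is_submodule D E -> D a -> E x -> E (a * x).
Proof. by case=> _ _; apply. Qed.
Lemma submodMr D E a x : is_submodule D E -> D a -> E x -> E (x * a).
Proof. by move=> hE Da Ex; rewrite mulrC; apply: submodM hE Da Ex. Qed.
Lemma submodN D E x : is_subring D -> is_submodule D E -> E x -> E (- x).
Proof.
move=> hD hE Ex; rewrite -mulN1r; apply: (submodM hE) => //.
by apply: subringN => //; apply: subring1.
Qed.
Lemma submodB D E x y : is_subring D -> is_submodule D E -> E x -> E y -> E (x - y).
Proof. by move=> hD hE Ex Ey; apply: (submodD hE) => //; apply: submodN hD hE Ey. Qed.
Lemma submod_sum D E (J : Type) (r : seq J) (p : pred J) (f : J -> K) :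
  is_submodule D E -> (forall i, p i -> E (f i)) -> E (\sum_(i <- r | p i) f i).
Proof.
by move=> hE Ef; apply: (big_ind E) => // [|x y]; [apply: submod0 hE|apply: submodD hE].
Qed.

Lemma submodW D T E : D `<=` T -> is_submodule T E -> is_submodule D E.
Proof. by move=> DT [E0 ED EM]; split=> // a x Da; apply: EM; apply: DT. Qed.

Lemma submod_subring D T : is_subring T -> D `<=` T -> is_submodule D T.
Proof.
move=> hT DT; split=> [|x y|a x Da Tx]; first exact: subring0.
  by move=> *; apply: subringD.
by apply: subringM => //; apply: DT.
Qed.

Lemma subring_overring D T : is_subring D -> is_subring T -> D `<=` T ->
  nonzero_submodules D T.
Proof.
move=> hD hT DT; split; first exact: submod_subring.
by exists 1; [apply: subring1|apply: oner_neq0].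
Qed.

Lemma submod1 D E : is_subring D -> is_submodule D E -> E 1 -> D `<=` E.
Proof. by move=> hD hE E1 x Dx; rewrite -(mulr1 x); apply: submodM hE Dx E1. Qed.

Lemma submod_setI D E F :
  is_submodule D E -> is_submodule D F -> is_submodule D (E `&` F).
Proof.
move=> hE hF; split=> [|x y [Ex Fx] [Ey Fy]|a x Da [Ex Fx]].
- by split; [apply: submod0 hE|apply: submod0 hF].
- by split; [apply: (submodD hE)|apply: (submodD hF)].
- by split; [apply: (submodM hE)|apply: (submodM hF)].
Qed.

Lemma submod_scale D E x : is_subring D -> is_submodule D E ->
  is_submodule D [set x * e | e in E].
Proof.
move=> hD hE; split=> [|_ _ [e Ee <-] [f Ef <-]|a _ Da [e Ee <-]].
- by exists 0; [apply: submod0 hE|rewrite mulr0].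
- by exists (e + f); [apply: (submodD hE)|rewrite mulrDr].
- by exists (a * e); [apply: (submodM hE)|rewrite mulrCA].
Qed.

Lemma prod_mod_mul E T e t : E e -> T t -> prod_mod E T (e * t).
Proof.
move=> Ee Tt; exists 1%N, (fun=> e), (fun=> t); split=> //.
by rewrite big_ord1.
Qed.

Lemma prod_mod_sub E T : T 1 -> E `<=` prod_mod E T.
Proof. by move=> T1 x Ex; rewrite -(mulr1 x); apply: prod_mod_mul. Qed.

Lemma prod_mod_min E T M : is_submodule T M -> E `<=` M -> prod_mod E T `<=` M.
Proof.
move=> hM EM _ [n [e [t [Ee Tt ->]]]]; apply: (submod_sum _ hM) => i _.
by apply: (submodMr hM) => //; apply: EM.
Qed.

Lemma prod_mod_submodule E T : is_subring T -> is_submodule T (prod_mod E T).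
Proof.
move=> hT; split.
- by exists 0%N, (fun=> 0), (fun=> 0); split=> [[]|[]|] //; rewrite big_ord0.
- move=> _ _ [n [e [t [Ee Tt ->]]]] [m [f [u [Ef Tu ->]]]].
  exists (n + m)%N.
  exists (fun i : 'I_(n + m)%N => match fintype.split i with inl a => e a | inr b => f b end).
  exists (fun i : 'I_(n + m)%N => match fintype.split i with inl a => t a | inr b => u b end).
  split=> [i|i|]; try by case: (fintype.split i).
  rewrite big_split_ord /=; congr (_ + _); apply: eq_bigr => i _.
    by rewrite (unsplitK (inl i)).
  by rewrite (unsplitK (inr i)).
- move=> a _ Ta [n [e [t [Ee Tt ->]]]].
  exists n, e, (fun i => a * t i); split=> // [i|]; first exact: subringM.
  by rewrite mulr_sumr; apply: eq_bigr => i _; rewrite mulrCA.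
Qed.

Lemma prod_modS E E' T T' :
  E `<=` E' -> T `<=` T' -> prod_mod E T `<=` prod_mod E' T'.
Proof.
move=> EE TT _ [n [e [t [Ee Tt ->]]]]; exists n, e, t; split=> // i.
  exact: EE.
exact: TT.
Qed.

Definition module_span D (s : seq K) : set K := prod_mod [set x | x \in s] D.

Lemma mem_span D (s : seq K) x : is_subring D -> x \in s -> module_span D s x.
Proof. by move=> hD xs; apply: prod_mod_sub xs; apply: subring1. Qed.

Lemma span_min D (s : seq K) M : is_submodule D M -> (forall x, x \in s -> M x) ->
  module_span D s `<=` M.
Proof. by move=> hM sM; apply: prod_mod_min. Qed.

Lemma span_submodule D (s : seq K) : is_subring D -> is_submodule D (module_span D s).
Proof. exact: prod_mod_submodule. Qed.

Lemma fg_span D (s : seq K) x : is_subring D -> x \in s -> x != 0 ->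
  fg_submodules D (module_span D s).
Proof.
move=> hD xs x0; split; last by exists s.
by split; [apply: span_submodule|exists x => //; apply: mem_span].
Qed.

Lemma prod_mod_span D T (s : seq K) : is_subring D -> is_subring T -> D `<=` T ->
  prod_mod (module_span D s) T = module_span T s.
Proof.
move=> hD hT DT; apply/seteqP; split.
  apply: prod_mod_min; first exact: span_submodule.
  apply: span_min => [|x xs]; last exact: mem_span.
  by apply: submodW DT _; apply: span_submodule.
apply: span_min => [|x xs]; first exact: prod_mod_submodule.
by apply: prod_mod_sub; [apply: subring1|apply: mem_span].
Qed.

Lemma prime_submod T Q : is_prime_ideal T Q -> is_submodule T Q.
Proof. by case=> [[]]. Qed.
Lemma prime_sub T Q : is_prime_ideal T Q -> Q `<=` T.
Proof. by case=> [[]]. Qed.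
Lemma prime_not1 T Q : is_prime_ideal T Q -> ~ Q 1.
Proof. by case. Qed.
Lemma primeM T Q x y :
  is_prime_ideal T Q -> T x -> T y -> ~ Q x -> ~ Q y -> ~ Q (x * y).
Proof. by case=> _ _ + Tx Ty Qx Qy Qxy; case/(_ _ _ Tx Ty Qxy). Qed.
Lemma prime_sub_or T Q x y :
  is_prime_ideal T Q -> T x -> T y -> Q (x * y) -> Q x \/ Q y.
Proof. by case=> _ _; apply. Qed.
Lemma primeX T Q x n : is_subring T ->
  is_prime_ideal T Q -> T x -> ~ Q x -> ~ Q (x ^+ n).
Proof.
move=> hT hQ Tx Qx; elim: n => [|n IH]; first exact: prime_not1 hQ.
by rewrite exprS; apply: (primeM hQ) => //; apply: subringX.
Qed.

Lemma prime0 D : is_subring D -> is_prime_ideal D [set 0].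
Proof.
move=> hD; split=> [||x y _ _ /= /eqP].
- split; last by move=> x ->; apply: subring0.
  by split=> [|x y -> ->|a x _ ->] //=; rewrite ?addr0 ?mulr0.
- by apply/eqP; apply: oner_neq0.
- by rewrite mulf_eq0 => /orP[] /eqP ->; [left|right].
Qed.

Lemma prime_setI T Q D : is_subring D -> D `<=` T -> is_prime_ideal T Q ->
  is_prime_ideal D (Q `&` D).
Proof.
move=> hD DT hQ; have hQm := prime_submod hQ; split.
- split=> [|x []] //; apply: submod_setI; first exact: submodW DT _.
  exact: submod_subring.
- by case=> /(prime_not1 hQ).
- move=> x y Dx Dy [Qxy _]; have [_ _ /(_ x y)] := hQ.
  by case=> //; do ?exact: DT; [left|right].
Qed.

Lemma prime_neq T Q : is_subring T -> is_prime_ideal T Q -> Q <> T.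
Proof. by move=> hT hQ QT; apply: (prime_not1 hQ); rewrite QT; apply: subring1. Qed.

(** For a [T]-submodule [E] and a prime [Q] this is [E T_Q] written without sums: a common
    denominator reduces a sum of fractions to a single one. *)
Definition saturation T Q E : set K := [set x | exists s, [/\ T s, ~ Q s & E (s * x)]].

Lemma localization_subring T Q : is_subring T -> is_prime_ideal T Q ->
  is_subring (localization T Q).
Proof.
move=> hT hQ; have Q0 := submod0 (prime_submod hQ).
have nz s : ~ Q s -> s != 0 by move=> Qs; apply: contra_notN Qs => /eqP ->.
split.
- exists 1, 1; rewrite divr1; split=> //; do ?exact: subring1.
  exact: prime_not1 hQ.
- move=> _ _ [a [s [Ta Ts Qs ->]]] [b [t [Tb Tt Qt ->]]].
  exists (a * t - b * s), (s * t); split.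
  + by apply: subringB => //; apply: subringM.
  + exact: subringM.
  + exact: (primeM hQ).
  + by field; rewrite !nz.
- move=> _ _ [a [s [Ta Ts Qs ->]]] [b [t [Tb Tt Qt ->]]].
  exists (a * b), (s * t); split; do ?exact: subringM.
  + exact: (primeM hQ).
  + by field; rewrite !nz.
Qed.

Lemma localization_sub T Q : is_subring T -> is_prime_ideal T Q ->
  T `<=` localization T Q.
Proof.
move=> hT hQ x Tx; exists x, 1; rewrite divr1; split=> //; first exact: subring1.
exact: prime_not1 hQ.
Qed.

Lemma localization_inv T Q s : is_subring T -> T s -> ~ Q s -> localization T Q s^-1.
Proof. by move=> hT Ts Qs; exists 1, s; rewrite div1r; split=> //; apply: subring1. Qed.

Lemma saturation_submodule T Q E : is_subring T -> is_prime_ideal T Q ->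
  is_submodule T E -> is_submodule (localization T Q) (saturation T Q E).
Proof.
move=> hT hQ hE; have Q0 := submod0 (prime_submod hQ).
have nz s : ~ Q s -> s != 0 by move=> Qs; apply: contra_notN Qs => /eqP ->.
split.
- exists 1; rewrite mulr0; split; [exact: subring1|exact: prime_not1 hQ|exact: submod0 hE].
- move=> x y [s [Ts Qs Ex]] [t [Tt Qt Ey]]; exists (s * t); split.
  + exact: subringM.
  + exact: (primeM hQ).
  + have -> : s * t * (x + y) = t * (s * x) + s * (t * y) by ring.
    by apply: (submodD hE); apply: (submodM hE).
- move=> _ x [a [t [Ta Tt Qt ->]]] [s [Ts Qs Ex]]; exists (s * t); split.
  + exact: subringM.
  + exact: (primeM hQ).
  + have -> : s * t * (a / t * x) = a * (s * x) by field; rewrite nz.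
    exact: (submodM hE).
Qed.

Lemma prod_localization T Q E : is_subring T -> is_prime_ideal T Q ->
  is_submodule T E -> prod_mod E (localization T Q) = saturation T Q E.
Proof.
move=> hT hQ hE; have Q0 := submod0 (prime_submod hQ).
have nz s : ~ Q s -> s != 0 by move=> Qs; apply: contra_notN Qs => /eqP ->.
apply/seteqP; split.
  apply: prod_mod_min; first exact: saturation_submodule.
  move=> x Ex; exists 1; rewrite mul1r; split=> //; first exact: subring1.
  exact: prime_not1 hQ.
move=> x [s [Ts Qs Ex]]; have -> : x = s * x * s^-1 by field; rewrite nz.
by apply: prod_mod_mul => //; apply: localization_inv.
Qed.

Lemma adjoin_subring D (S : set K) : is_subring (adjoin D S).
Proof.
split=> [|x y Dx Dy|x y Dx Dy] T [hT DT].
- exact: subring1.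
- by apply: subringB => //; [apply: Dx|apply: Dy].
- by apply: subringM => //; [apply: Dx|apply: Dy].
Qed.

Lemma adjoin_overring D (S : set K) : is_overring D (adjoin D S).
Proof.
split; first exact: adjoin_subring.
by move=> x Dx T [_]; apply; left.
Qed.

Lemma mem_adjoin D (S : set K) : S `<=` adjoin D S.
Proof. by move=> x Sx T [_]; apply; right. Qed.

Lemma adjoin_min D (S : set K) T :
  is_subring T -> D `<=` T -> S `<=` T -> adjoin D S `<=` T.
Proof. by move=> hT DT ST; apply: smallest_sub => // x [/DT|/ST]. Qed.

End SubringsAndModules.

Lemma properE_exists (X : Type) (A B : set X) :
  (A `<` B)%classic <-> (A `<=` B)%classic /\ exists2 x, B x & ~ A x.
Proof.
split=> -[AB BA]; split=> //; last by case: BA => x Bx Ax /(_ x Bx).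
by have /existsNP[x /not_implyP[Bx Ax]] := BA; exists x.
Qed.

(** The finiteness behind every use of Zorn's lemma below: a ring identity or a finite generating
    set found in the union of a chain already lies in one member. *)
Lemma chain_finite_cover (X : eqType) (F : set (set X)) (s : seq X) :
  (F !=set0)%classic -> total_on F subset ->
  (forall x, x \in s -> exists2 A, F A & A x) ->
  exists2 A, F A & forall x, x \in s -> A x.
Proof.
move=> [A0 FA0] Ftot; elim: s => [|y s IH] Fs; first by exists A0.
have [|A FA As] := IH; first by move=> x xs; apply: Fs; rewrite inE xs orbT.
have [|B FB By] := Fs y; first by rewrite mem_head.
have [AB|BA] := Ftot _ _ FA FB.
  by exists B => // x; rewrite inE => /predU1P[->|/As/AB].
by exists A => // x; rewrite inE => /predU1P[->|/As] //; apply: BA.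
Qed.

(* [Zorn_bigcup] above a given set [A0], so that only nonempty chains have to
   be bounded. *)
Lemma Zorn_above (X : Type) (Pr : set (set X)) (A0 : set X) : Pr A0 ->
  (forall F : set (set X), (F !=set0)%classic -> (F `<=` Pr)%classic ->
     total_on F subset -> Pr (\bigcup_(A in F) A)%classic) ->
  exists A, [/\ Pr A, (A0 `<=` A)%classic &
    forall B, Pr B -> (A `<=` B)%classic -> B = A].
Proof.
(* Joining [A0] makes the empty chain harmless: its empty union then stands for [A0] itself. *)
move=> PA0 chainP; pose Pr' := [set A | Pr (A `|` A0)]%classic.
have [F FPr' Ftot|A [PA Amax]] := @Zorn_bigcup X Pr'.
  have [F0|/set0P Fn0] := eqVneq F set0.
    by rewrite /Pr' /= F0 bigcup_set0 set0U.
  suff -> : Pr' (\bigcup_(X0 in F) X0)%classic =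
      Pr (\bigcup_(B in [set (C `|` A0)%classic | C in F]) B)%classic.
    apply: chainP.
    - by have [C FC] := Fn0; exists (C `|` A0)%classic, C.
    - by move=> _ [C FC <-]; apply: FPr'.
    - move=> _ _ [C FC <-] [C' FC' <-].
      by have [CC|CC] := Ftot _ _ FC FC'; [left|right]; apply: setSU.
  rewrite /Pr' /=; congr Pr; apply/seteqP; split=> x.
    case=> [[C FC Cx]|A0x]; first by exists (C `|` A0)%classic; [exists C|left].
    by have [C FC] := Fn0; exists (C `|` A0)%classic; [exists C|right].
  by move=> [_ [C FC <-] [Cx|A0x]]; [left; exists C|right].
exists (A `|` A0)%classic; split=> // B PB AB; apply: contrapT => nB.
have A0B : (A0 `<=` B)%classic by move=> x A0x; apply: AB; right.
apply: (Amax B); last by rewrite /Pr' /= setUidl.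
split=> [x Ax|BA]; first by apply: AB; left.
by apply: nB; apply/seteqP; split=> // x Bx; left; apply: BA.
Qed.

(** * Valuation rings and Chevalley's theorem *)

Section PolySet.
Local Open Scope classical_set_scope.
Local Open Scope ring_scope.
Variable K : fieldType.
Implicit Types (A E I : set K) (p q : {poly K}).

Lemma poly_setD A E p q : is_submodule A E ->
  poly_set E p -> poly_set E q -> poly_set E (p + q).
Proof. by move=> hE hp hq i; rewrite coefD; apply: (submodD hE). Qed.

Lemma poly_setM A E p q : is_submodule A E ->
  poly_set A p -> poly_set E q -> poly_set E (p * q).
Proof.
move=> hE hp hq i; rewrite coefM; apply: (submod_sum _ hE) => j _.
exact: (submodM hE).
Qed.

Lemma poly_setC E (x : K) : E 0 -> E x -> poly_set E x%:P.
Proof. by move=> E0 Ex i; rewrite coefC; case: ifP. Qed.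

Lemma poly_setX A : A 0 -> A 1 -> poly_set A 'X.
Proof. by move=> A0 A1 i; rewrite coefX; case: (i == _). Qed.

Lemma poly_set_subring A : is_subring A ->
  [/\ poly_set A 1, forall p q, poly_set A p -> poly_set A q -> poly_set A (p - q)
    & forall p q, poly_set A p -> poly_set A q -> poly_set A (p * q)].
Proof.
move=> hA; have hAm : is_submodule A A by apply: submod_subring.
split=> [|p q hp hq i|p q]; last exact: poly_setM hAm.
  by apply: poly_setC; [apply: subring0|apply: subring1].
by rewrite coefB; apply: subringB.
Qed.

(** For a ring [A] this is [A[x]]. Modules are allowed because Chevalley's argument needs [I[x]],
    the ideal of [A[x]] generated by an ideal [I] of [A]. *)
Definition evals E x : set K := [set y | exists2 p, poly_set E p & y = p.[x]].

Lemma evals_subring A x : is_subring A -> is_subring (evals A x).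
Proof.
move=> hA; have [h1 hB hM] := poly_set_subring hA; split.
- by exists 1 => //; rewrite hornerC.
- move=> _ _ [p hp ->] [q hq ->]; exists (p - q); first exact: hB.
  by rewrite hornerD hornerN.
- move=> _ _ [p hp ->] [q hq ->]; exists (p * q); first exact: hM.
  by rewrite hornerM.
Qed.

Lemma sub_evals E x : E 0 -> E `<=` evals E x.
Proof. by move=> E0 y Ey; exists y%:P; [apply: poly_setC|rewrite hornerC]. Qed.

Lemma mem_evals A x : is_subring A -> evals A x x.
Proof.
move=> hA; exists 'X; last by rewrite hornerX.
by apply: poly_setX; [apply: subring0|apply: subring1].
Qed.

Lemma evals_submodule A E x : is_submodule A E ->
  is_submodule (evals A x) (evals E x).
Proof.
move=> hE; split.
- by apply: sub_evals; apply: submod0 hE.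
- move=> _ _ [p hp ->] [q hq ->]; exists (p + q); first exact: (poly_setD hE).
  by rewrite hornerD.
- move=> _ _ [p hp ->] [q hq ->]; exists (p * q); first exact: (poly_setM hE).
  by rewrite hornerM.
Qed.

End PolySet.

Section Valuations.
Local Open Scope classical_set_scope.
Local Open Scope ring_scope.
Variable K : fieldType.
Implicit Types (A R V W P I : set K) (p q r : {poly K}).

Definition is_valuation_ring W :=
  is_subring W /\ forall x, x != 0 -> W x \/ W x^-1.

(** The nonunits. In a valuation ring they lie in [W] automatically; [0] is listed separately
    because [0^-1] is [0], which does belong to [W]. *)
Definition maxideal W : set K := [set x | x = 0 \/ ~ W x^-1].

Lemma maxideal_sub W : is_valuation_ring W -> maxideal W `<=` W.
Proof.
move=> [hW valW] x [->|Wx]; first exact: subring0.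
have [->|/valW[//|//]] := eqVneq x 0; exact: subring0.
Qed.

Lemma maxideal_unit W x : x != 0 -> W x^-1 -> ~ maxideal W x.
Proof. by move=> x0 Wx [/eqP|//]; apply/negP. Qed.

Lemma maxideal_inv W x : ~ maxideal W x -> x != 0 /\ W x^-1.
Proof.
move=> mx; split; last by apply: contrapT => Wx; apply: mx; right.
by apply: contra_notN mx => /eqP ->; left.
Qed.

Lemma maxideal_prime W : is_valuation_ring W -> is_prime_ideal W (maxideal W).
Proof.
move=> hvW; have [hW valW] := hvW.
have mD x y : x != 0 -> maxideal W x -> W (y / x) -> maxideal W (x + y).
  move=> x0 mx Wyx; apply: contrapT => /maxideal_inv[xy0 Wxy].
  case: mx => [/eqP|]; first exact/negP.
  move=> nWx; apply: nWx.
  have -> : x^-1 = (1 + y / x) * (x + y)^-1 by field; rewrite x0 xy0.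
  by apply: subringM => //; apply: subringD => //; apply: subring1.
split.
- split; last exact: maxideal_sub.
  split; first by left.
  + move=> x y mx my.
    have [->|x0] := eqVneq x 0; first by rewrite add0r.
    have [->|y0] := eqVneq y 0; first by rewrite addr0.
    case: (valW (y / x)); first by rewrite mulf_neq0 ?invr_eq0.
      exact: mD.
    by rewrite invf_div addrC; apply: mD.
  + move=> a x Wa mx; apply: contrapT => /maxideal_inv[ax0 Wax].
    move: (ax0); rewrite mulf_eq0 negb_or => /andP[a0 x0].
    apply: maxideal_unit mx => //; have -> : x^-1 = a * (a * x)^-1.
      by field; rewrite x0 a0.
    exact: subringM.
- by apply: maxideal_unit; [apply: oner_neq0|rewrite invr1; apply: subring1].
- move=> x y Wx Wy mxy; apply: contrapT => /not_orP[/maxideal_inv[x0 Wx']].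
  move=> /maxideal_inv[y0 Wy']; apply: maxideal_unit mxy.
    by rewrite mulf_neq0.
  by rewrite invfM; apply: subringM.
Qed.

Lemma maxidealS V W : is_valuation_ring V -> V `<=` W ->
  maxideal W `<=` maxideal V.
Proof. by move=> hV VW x [->|Wx]; [left|right=> /VW]. Qed.

Lemma sub_of_maxidealS V W : is_valuation_ring V -> is_valuation_ring W ->
  maxideal W `<=` maxideal V -> V `<=` W.
Proof.
move=> hV [hW valW] mWV x Vx; have [->|x0] := eqVneq x 0; first exact: subring0.
apply: contrapT => Wx; have /mWV : maxideal W x^-1 by right; rewrite invrK.
by apply: maxideal_unit; [rewrite invr_eq0|rewrite invrK].
Qed.

Lemma prime_sub_maxideal W P : is_valuation_ring W -> is_prime_ideal W P ->
  P `<=` maxideal W.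
Proof.
move=> [hW _] hP x Px; apply: contrapT => /maxideal_inv[x0 Wx].
apply: (prime_not1 hP); rewrite -(mulVf x0).
exact: submodM (prime_submod hP) _ _.
Qed.

Section Chevalley.
Variables (A P : set K).
Hypotheses (hA : is_subring A) (PA1 : ~ prod_mod P A 1).
Hypothesis Amax : forall B, is_subring B -> A `<=` B -> ~ prod_mod P B 1 -> B = A.

Let I := prod_mod P A.
Let hI : is_submodule A I. Proof. exact: prod_mod_submodule. Qed.
Let PI : P `<=` I. Proof. by apply: prod_mod_sub; apply: subring1. Qed.

(** Adjoining the inverse of [u = 1 - x] gives the ring [B]. If [P] generated the unit ideal there,
    some [u ^+ k] would lie in [I]; since [u] is [1] modulo [I], descending on [k] would give [1] in
    [I]. Maximality then forces [B = A]. *)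
Let inv_1sub x : A x -> I x -> 1 - x != 0 /\ A (1 - x)^-1.
Proof.
move=> Ax Ix; have x1 : 1 - x != 0.
  by rewrite subr_eq0; apply: contra_notN PA1 => /eqP ->.
split=> //; pose u := 1 - x; have Au : A u by apply: subringB => //; apply: subring1.
pose B := [set y : K | exists k, A (u ^+ k * y)].
have AB : A `<=` B by move=> y Ay; exists 0%N; rewrite mul1r.
have <- : B = A; last by exists 1%N; rewrite mulfV //; apply: subring1.
apply: Amax => //.
  split; first by apply: AB; apply: subring1.
    move=> y z [k Ay] [j Az]; exists (k + j)%N.
    have -> : u ^+ (k + j) * (y - z) = u ^+ j * (u ^+ k * y) - u ^+ k * (u ^+ j * z).
      by rewrite exprD; ring.
    by apply: subringB => //; apply: subringM => //; apply: subringX.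
  move=> y z [k Ay] [j Az]; exists (k + j)%N.
  have -> : u ^+ (k + j) * (y * z) = (u ^+ k * y) * (u ^+ j * z).
    by rewrite exprD; ring.
  exact: subringM.
move=> PB1; suff [k] : exists k, I (u ^+ k * 1).
  rewrite mulr1; elim: k => [|k IH] // Ik; apply: IH.
  have -> : u ^+ k = u ^+ k.+1 + u ^+ k * x by rewrite exprS /u; ring.
  by apply: submodD hI Ik _; apply: submodM hI _ Ix; apply: subringX.
have [] // := @prod_mod_min _ P B [set y | exists k, I (u ^+ k * y)] _ _ 1 PB1.
- split; first by exists 0%N; rewrite mulr0; apply: submod0 hI.
    move=> y z [k Iy] [j Iz]; exists (k + j)%N.
    have -> : u ^+ (k + j) * (y + z) = u ^+ j * (u ^+ k * y) + u ^+ k * (u ^+ j * z).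
      by rewrite exprD; ring.
    by apply: (submodD hI); apply: (submodM hI) => //; apply: subringX.
  move=> y z [k Ay] [j Iz]; exists (k + j)%N.
  have -> : u ^+ (k + j) * (y * z) = (u ^+ k * y) * (u ^+ j * z).
    by rewrite exprD; ring.
  exact: (submodM hI).
- by move=> y Py; exists 0%N; rewrite mul1r; apply: PI.
- by move=> k Ik; exists k.
Qed.

Let I_sub_A : P `<=` A -> I `<=` A.
Proof. by move=> PA; apply: prod_mod_min => //; apply: submod_subring. Qed.

(** By maximality [P] generates the unit ideal of the strictly larger ring [A[x]], so [1] is a
    polynomial in [x] with coefficients in [I]. *)
Let relation x : ~ A x -> exists2 q, poly_set I q & q.[x] = 1.
Proof.
move=> Ax; suff [q hq ->] : evals I x 1 by exists q.
have PB1 : prod_mod P (evals A x) 1.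
  apply: contrapT => PB1; apply: Ax; rewrite -(Amax _ _ PB1); first exact: mem_evals.
    exact: evals_subring.
  by apply: sub_evals; apply: subring0.
apply: (@prod_mod_min _ P (evals A x)) PB1; first exact: evals_submodule.
by move=> y Py; apply: sub_evals; [apply: submod0 hI|apply: PI].
Qed.

(** Multiplied by [x ^+ m], the relation for [x^-1] expresses [(1 - r_0) x^m] through lower powers
    of [x] with coefficients in [I]. As [1 - r_0] is a unit, this eliminates the term of degree [m]
    from [q]; the bound on the size of [r] ensures that no negative power remains. *)
Let reduce x q r : P `<=` A -> x != 0 -> (size r <= size q)%N ->
  poly_set I q -> q.[x] = 1 -> poly_set I r -> r.[x^-1] = 1 ->
  exists q', [/\ poly_set I q', q'.[x] = 1 & (size q' < size q)%N].
Proof.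
move=> PA x0 rq hq qx hr rx; have IA := I_sub_A PA.
have [m qm] : exists m, size q = m.+1.
  case E : (size q) => [|m]; last by exists m.
  by move: qx; rewrite (eqP (_ : q == 0)) -?size_poly_eq0 ?E // horner0 => /esym/eqP; rewrite oner_eq0.
have [u0 Au] : 1 - r`_0 != 0 /\ A (1 - r`_0)^-1.
  by apply: inv_1sub => //; apply: IA.
exists (\poly_(i < m) (q`_i + q`_m * (1 - r`_0)^-1 * r`_(m - i))); split.
- move=> i; rewrite coef_poly; case: ifP => _; last exact: submod0 hI.
  apply: (submodD hI) => //; apply: (submodM hI) => //.
  by apply: subringM => //; apply: IA.
- have xr : \sum_(i < m) r`_(m - i) * x ^+ i = x ^+ m * (1 - r`_0).
    have := congr1 (fun z => x ^+ m * z) rx.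
    rewrite mulr1 (@horner_coef_wide _ m.+1 r) -?qm // mulr_sumr qm.
    rewrite (reindex_inj rev_ord_inj) big_ord_recr /= subnn expr0 mulr1.
    move=> E; rewrite mulrBr mulr1 -[X in X - _]E addrK; apply: eq_bigr => i _.
    rewrite subSS exprVn mulrCA; congr (_ * _).
    have im : (i <= m)%N by rewrite ltnW.
    by rewrite -{2}(subnK im) exprD mulrAC mulfV ?mul1r // expf_neq0.
  rewrite horner_poly -[RHS]qx (@horner_coef_wide _ m.+1 q) ?qm // big_ord_recr /=.
  under eq_bigr do rewrite mulrDl -mulrA.
  rewrite big_split -mulr_sumr xr /=; congr (_ + _); field.
  exact: u0.
- by rewrite qm ltnS size_poly.
Qed.

(** If neither [x] nor [x^-1] were in [A], both would satisfy a relation over [I], and [reduce]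
    would shorten the longer of the two relations forever. *)
Lemma maximal_valuation : P `<=` A -> is_valuation_ring A.
Proof.
move=> PA; split=> // x x0; apply: contrapT => /not_orP[Ax Ax'].
have [q hq qx] := relation Ax; have [r hr rx] := relation Ax'.
have [k] := ubnP (size q + size r).
elim: k x x0 q r {Ax Ax'} hq qx hr rx => // k IH x x0 q r hq qx hr rx ltk.
have [rq|/ltnW qr] := leqP (size r) (size q).
  have [q' [hq' qx' sq']] := reduce PA x0 rq hq qx hr rx.
  by apply: (IH x x0 q' r) => //; lia.
have x0' : x^-1 != 0 by rewrite invr_eq0.
have [|r' [hr' rx' sr']] := reduce PA x0' qr hr rx hq; first by rewrite invrK.
by apply: (IH x x0 q r') => //; lia.
Qed.

End Chevalley.

(** Zorn's lemma starts from [R_P] rather than [R]: the elements of [R] outside [P] are then units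
    of [W], which makes the trace of the maximal ideal equal to [P] and not merely larger. *)
Lemma chevalley R P : is_subring R -> is_prime_ideal R P ->
  exists W, [/\ is_valuation_ring W, R `<=` W & maxideal W `&` R = P].
Proof.
move=> hR hP; pose Pr A := is_subring A /\ ~ prod_mod P A 1.
have [||A [[hA PA1] A0A Amax]] := @Zorn_above _ Pr (localization R P).
- split; first exact: localization_subring.
  rewrite prod_localization //; last exact: prime_submod.
  by case=> s [_ Ps]; rewrite mulr1.
- move=> F Fn0 FPr Ftot; have cov := chain_finite_cover Fn0 Ftot.
  split.
    split.
    + by have [A FA] := Fn0; exists A => //; apply: subring1; case: (FPr _ FA).
    + move=> x y [A FA Ax] [B FB By]; have [z|C FC Cs] := cov [:: x; y].
        by rewrite !inE => /orP[] /eqP ->; [exists A|exists B].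
      have [hC _] := FPr _ FC.
      by exists C => //; apply: subringB => //; apply: Cs; rewrite !inE eqxx ?orbT.
    + move=> x y [A FA Ax] [B FB By]; have [z|C FC Cs] := cov [:: x; y].
        by rewrite !inE => /orP[] /eqP ->; [exists A|exists B].
      have [hC _] := FPr _ FC.
      by exists C => //; apply: subringM => //; apply: Cs; rewrite !inE eqxx ?orbT.
  move=> [n [e [t [Pe Ut def1]]]].
  have [x|C FC Cs] := cov [seq t i | i <- enum 'I_n].
    by move=> /mapP[i _ ->]; have [A] := Ut i; exists A.
  have [_] := FPr _ FC; apply; exists n, e, t; split=> // i.
  by apply: Cs; apply: map_f; rewrite mem_enum.
have RA : R `<=` A by move=> x Rx; apply: A0A; apply: localization_sub.
have PA : P `<=` A by move=> x /(prime_sub hP)/RA.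
exists A; split=> //.
  by apply: maximal_valuation PA => // B hB AB PB1; apply: Amax.
apply/seteqP; split=> x.
  move=> [mx Rx]; apply: contrapT => Px.
  have x0 : x != 0 by apply: contra_notN Px => /eqP ->; apply: submod0 (prime_submod hP).
  apply: maxideal_unit mx => //; apply: A0A; exact: localization_inv.
move=> Px; split; last exact: prime_sub hP _ Px.
apply: contrapT => /maxideal_inv[x0 Ax]; apply: PA1; rewrite -(mulfV x0).
exact: prod_mod_mul.
Qed.

(** Starting at zero makes [l] the number of nonzero primes, the quantity counted by the star
    dimension; the values of [P] beyond [l] are irrelevant. *)
Definition prime_chain R (P : nat -> set K) l := P 0%N = [set 0] /\
  forall i, (i < l)%N -> P i `<` P i.+1 /\ is_prime_ideal R (P i.+1).

Lemma prime_chain_prime R (P : nat -> set K) l i : is_subring R -> prime_chain R P l ->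
  (i <= l)%N -> is_prime_ideal R (P i).
Proof.
move=> hR [P0 hP]; case: i => [_|i /hP[]//]; rewrite P0; exact: prime0.
Qed.

Lemma prime_chain_mono R (P : nat -> set K) l i j : prime_chain R P l ->
  (i <= j)%N -> (j <= l)%N -> P i `<=` P j.
Proof.
move=> [P0 hP]; elim: j => [|j IH]; first by rewrite leqn0 => /eqP -> _ x.
rewrite leq_eqVlt ltnS => /predU1P[->|ij] jl x Pix //.
have [/properW Pj _] := hP _ jl; apply: Pj.
exact: IH ij (ltnW jl) _ Pix.
Qed.

Lemma prime_chainW R (P : nat -> set K) l k : prime_chain R P l -> (k <= l)%N -> prime_chain R P k.
Proof. by move=> [P0 hP] kl; split=> // i ik; apply: hP; apply: leq_trans kl. Qed.

(* Chevalley's theorem on [R + maxideal W] refines a valuation ring [W] centred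
   on [P] to one centred on [P']. *)
Lemma valuation_refine R W P P' : is_subring R -> is_valuation_ring W ->
  R `<=` W -> maxideal W `&` R = P -> P `<=` P' -> is_prime_ideal R P' ->
  exists V, [/\ is_valuation_ring V, V `<=` W, R `<=` V & maxideal V `&` R = P'].
Proof.
move=> hR hvW RW mWR PP' hP'; have [hW _] := hvW; have hm := maxideal_prime hvW.
have hmm := prime_submod hm; have hP'm := prime_submod hP'.
pose sum (E : set K) := [set z | exists x y, [/\ E x, maxideal W y & z = x + y]].
(* The summands [R] and [maxideal W] overlap only inside [P'], so an equation in [sum R] between
   elements of [R] can be read modulo [P']. *)
have mP' x : R x -> maxideal W x -> P' x by move=> Rx mx; apply: PP'; rewrite -mWR.
have sumE E : E `<=` sum E.
  by move=> x Ex; exists x, 0; rewrite addr0; split=> //; apply: submod0 hmm.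
have summ E : E 0 -> maxideal W `<=` sum E.
  by move=> E0 x mx; exists 0, x; rewrite add0r.
have hsR : is_subring (sum R).
  split; first by apply: sumE; apply: subring1.
    move=> _ _ [a [x [Ra mx ->]]] [b [y [Rb my ->]]]; exists (a - b), (x - y).
    split; [exact: subringB|exact: (submodB hW hmm)|by ring].
  move=> _ _ [a [x [Ra mx ->]]] [b [y [Rb my ->]]].
  exists (a * b), (a * y + (b * x + x * y)); split; [exact: subringM| |by ring].
  apply: (submodD hmm); first by apply: (submodM hmm) => //; apply: RW.
  apply: (submodD hmm); first by apply: (submodM hmm) => //; apply: RW.
  by apply: (submodM hmm) => //; apply: maxideal_sub.
have hsP : is_prime_ideal (sum R) (sum P').
  split.
  - split; last first.
      move=> _ [a [x [Pa mx ->]]]; exists a, x; split=> //; exact: prime_sub hP' _ Pa.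
    split; first by apply: sumE; apply: submod0 hP'm.
      move=> _ _ [a [x [Ra mx ->]]] [b [y [Rb my ->]]]; exists (a + b), (x + y).
      split; [exact: submodD hP'm _ _|exact: (submodD hmm)|by ring].
    move=> _ _ [a [x [Ra mx ->]]] [b [y [Pb my ->]]].
    exists (a * b), (a * y + (b * x + x * y)); split.
    + exact: submodM hP'm _ _.
    + have Rb : R b by apply: prime_sub hP' _ Pb.
      apply: (submodD hmm); first by apply: (submodM hmm) => //; apply: RW.
      apply: (submodD hmm); first by apply: (submodM hmm) => //; apply: RW.
      by apply: (submodM hmm) => //; apply: maxideal_sub.
    + by ring.
  - move=> [a [x [Pa mx def1]]]; apply: (prime_not1 hP').
    have Ra := prime_sub hP' Pa.
    rewrite def1; apply: (submodD hP'm Pa); apply: mP' => //.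
    have -> : x = 1 - a by rewrite def1; ring.
    by apply: subringB => //; apply: subring1.
  - move=> _ _ [a [x [Ra mx ->]]] [b [y [Rb my ->]]] [c [z [Pc mz defc]]].
    have Rc := prime_sub hP' Pc.
    suff /(prime_sub_or hP' Ra Rb) [Pa|Pb] : P' (a * b).
    + by left; exists a, x.
    + by right; exists b, y.
    have -> : a * b = c + (a * b - c) by ring.
    apply: (submodD hP'm Pc); apply: mP'; first by apply: subringB => //; apply: subringM.
    have -> : a * b - c = z - (a * y + (b * x + x * y)).
      by have /(congr1 (fun t => t - c - (a * y + (b * x + x * y)))) := defc;
        rewrite (_ : _ - c - _ = a * b - c); [move=> ->; ring|ring].
    apply: (submodB hW hmm mz).
    apply: (submodD hmm); first by apply: (submodM hmm) => //; apply: RW.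
    apply: (submodD hmm); first by apply: (submodM hmm) => //; apply: RW.
    by apply: (submodM hmm) => //; apply: maxideal_sub.
have [V [hV sRV mV]] := chevalley hsR hsP; exists V.
have RV : R `<=` V by move=> x Rx; apply: sRV; apply: sumE.
split=> //.
  apply: sub_of_maxidealS => // x mx.
  by have : sum P' x; [apply: summ => //; apply: submod0 hP'm|rewrite -mV => -[]].
apply/seteqP; split=> x.
  move=> [mx Rx]; have : sum P' x by rewrite -mV; split=> //; apply: sumE.
  move=> [a [y [Pa my defx]]]; rewrite defx; apply: (submodD hP'm Pa).
  apply: mP' => //; have -> : y = x - a by rewrite defx; ring.
  by apply: subringB => //; apply: prime_sub hP' _ Pa.
move=> Px; split; last exact: prime_sub hP' _ Px.
by have : sum P' x; [apply: sumE|rewrite -mV => -[]].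
Qed.

(** Each new prime shrinks the valuation ring from [W] to [V]. The primes of [W] found so far stay
    prime in [V], because they lie in [maxideal W], hence in [maxideal V]; the inclusions stay
    strict because their traces on [R] are distinct. *)
Lemma prime_chain_lift R (P : nat -> set K) l : is_subring R -> prime_chain R P l ->
  exists W Q, [/\ is_valuation_ring W, R `<=` W, prime_chain W Q l,
    Q l = maxideal W & forall i, (i <= l)%N -> Q i `&` R = P i].
Proof.
move=> hR; elim: l => [|l IH] hP.
  exists setT, (fun=> [set 0]); split=> //.
  - by split=> // x _; left.
  - by apply/seteqP; split=> x; [move=> x0; left|case=> // nx; case: nx].
  - move=> i; rewrite leqn0 => /eqP ->; have [-> _] := hP.
    by apply/seteqP; split=> [x []|x ->] //; split=> //; apply: subring0.
have [|W [Q [hW RW hQ Ql QR]]] := IH; first exact: prime_chainW hP _.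
have [/properW PP' hP'] := (hP.2 l (ltnSn l)).
have mWR : maxideal W `&` R = P l by rewrite -Ql QR.
have [V [hV VW RV mV]] := valuation_refine hR hW RW mWR PP' hP'.
have mWV := maxidealS hV VW; have mVV := maxideal_sub hV.
exists V, (fun i => if (i <= l)%N then Q i else maxideal V).
have QlR i : (i <= l.+1)%N -> (if (i <= l)%N then Q i else maxideal V) `&` R = P i.
  rewrite leq_eqVlt => /predU1P[->|]; first by rewrite ltnn mV.
  by rewrite ltnS => il; rewrite il QR.
split=> //; last by rewrite ltnn.
have QW i : (i <= l)%N -> Q i `<=` maxideal W.
  by move=> il; rewrite -Ql; apply: prime_chain_mono hQ il _.
split; first by rewrite leq0n; case: hQ.
move=> i il; rewrite ltnS in il; rewrite il.
have strict A B : A `<=` B -> A `&` R = P i -> B `&` R = P i.+1 -> A `<` B.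
  move=> AB hA hB; apply/properE_exists; split=> //.
  have [/properE_exists[_ [x Px Px']] _] := hP.2 i il; exists x.
    by move: Px; rewrite -hB => -[].
  move=> Ax; apply: Px'; rewrite -hA; split=> //.
  by move: Px; rewrite -hB => -[].
have Hi := QlR i (leqW il); rewrite il in Hi.
have Hi1 := QlR i.+1 il; split.
  apply: strict Hi Hi1; case: ltnP => il'.
    by have [/properW] := hQ.2 i il'.
  by move=> x /QW => /(_ il)/mWV.
case: ltnP => il'; last exact: maxideal_prime.
have hQi : is_prime_ideal W (Q i.+1) by have [] := hQ.2 i il'.
have hQm := prime_submod hQi; split.
- split; first exact: submodW VW hQm.
  by move=> x /QW => /(_ il')/mWV/mVV.
- exact: prime_not1 hQi.
- by move=> x y /VW Wx /VW Wy; case: hQi => _ _; apply.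
Qed.

End Valuations.

(** * Restricting valuation rings from K(X) to K *)

Section RationalFunctions.
Local Open Scope classical_set_scope.
Local Open Scope ring_scope.

Lemma fraction_quotient (R : idomainType) (f : {fraction R}) :
  exists n d : R, d != 0 /\ f = tofrac n / tofrac d.
Proof.
elim/quotW: f => r; have d0 := denom_ratioP r.
exists (frac r).1, (frac r).2; split=> //.
apply: (canRL (mulfK _)); first by rewrite tofrac_eq0.
unlock FracField.tofrac; rewrite -[LHS]FracField.pi_mul; apply/eqmodP.
rewrite /= FracField.equivfE /FracField.mulf /= !numden_Ratio ?mulf_neq0 ?oner_eq0 //.
by rewrite !mulr1 mulrC.
Qed.

Lemma poly_family_dependent (K : fieldType) (I : finType) (u : I -> {poly K}) d :
  (forall i, (size (u i) <= d)%N) -> (d < #|I|)%N ->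
  exists2 c : I -> K, exists i, c i != 0 & \sum_i c i *: u i = 0.
Proof.
move=> su dI; pose M : 'M[K]_(#|I|, d) := \matrix_i poly_rV (u (enum_val i)).
have : kermx M != 0.
  rewrite kermx_eq0 /row_free; apply: contraL dI => /eqP rM.
  by rewrite -leqNgt -rM rank_leq_col.
move=> /matrix0Pn[i [j kij]]; exists (fun x => kermx M i (enum_rank x)).
  by exists (enum_val j); rewrite enum_valK.
apply/polyP => k; rewrite coef_sum coef0.
have [kd|dk] := ltnP k d; last first.
  by apply: big1 => x _; rewrite coefZ nth_default ?mulr0 // (leq_trans (su x)).
have := congr1 (fun A : 'M_(_, d) => A i (Ordinal kd)) (mulmx_ker M).
rewrite !mxE => ker0; apply: etrans ker0.
rewrite (reindex _ (onW_bij _ (@enum_val_bij I))) /=.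
by apply: eq_bigr => x _; rewrite coefZ enum_valK !mxE.
Qed.

Lemma clear_denominators (F : fieldType) (c n1 d1 n2 d2 : F) i j N :
  d1 != 0 -> d2 != 0 -> (i <= N)%N -> (j <= N)%N ->
  d1 ^+ N * d2 ^+ N * (c * ((n1 / d1) ^+ i * (n2 / d2) ^+ j)) =
  c * (n1 ^+ i * d1 ^+ (N - i) * (n2 ^+ j * d2 ^+ (N - j))).
Proof.
move=> d10 d20 iN jN; rewrite !expr_div_n.
have -> : d1 ^+ N = d1 ^+ (N - i) * d1 ^+ i by rewrite -exprD subnK.
have -> : d2 ^+ N = d2 ^+ (N - j) * d2 ^+ j by rewrite -exprD subnK.
have := expf_neq0 i d10; have := expf_neq0 j d20.
move: (d1 ^+ i) (d2 ^+ j) (d1 ^+ (N - i)) (d2 ^+ (N - j)) (n1 ^+ i) (n2 ^+ j).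
by move=> a b a' b' u v b0 a0; field; rewrite a0 b0.
Qed.

Lemma monomial_neq0 (F : fieldType) (c f g : F) a b :
  c != 0 -> f != 0 -> g != 0 -> c * (f ^+ a * g ^+ b) != 0.
Proof. by move=> c0 f0 g0; rewrite !mulf_neq0 ?expf_neq0. Qed.

Lemma monomial_quotientl (F : fieldType) (c f g : F) a1 a2 b1 b2 :
  f != 0 -> g != 0 -> (a1 <= a2)%N ->
  c * (f ^+ a1 * g ^+ b1) / (f ^+ a2 * g ^+ b2) =
  c * g ^+ b1 / (f ^+ (a2 - a1) * g ^+ b2).
Proof.
move=> f0 g0 le_a; rewrite -{1}(subnK le_a) exprD.
have := expf_neq0 a1 f0; have := expf_neq0 (a2 - a1) f0; have := expf_neq0 b2 g0.
move: (f ^+ a1) (f ^+ (a2 - a1)) (g ^+ b1) (g ^+ b2) => x y z t t0 y0 x0.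
by field; rewrite x0 y0 t0.
Qed.

Lemma monomial_quotientr (F : fieldType) (c f g : F) a b1 b2 :
  f != 0 -> g != 0 -> (b1 <= b2)%N ->
  c * (f ^+ a * g ^+ b1) / (f ^+ a * g ^+ b2) = c / g ^+ (b2 - b1).
Proof.
move=> f0 g0 le_b; rewrite -{1}(subnK le_b) exprD.
have := expf_neq0 a f0; have := expf_neq0 b1 g0; have := expf_neq0 (b2 - b1) g0.
move: (f ^+ a) (g ^+ b1) (g ^+ (b2 - b1)) => x y z z0 y0 x0.
by field; rewrite x0 y0 z0.
Qed.

Variable K : fieldType.
Implicit Types (f g : ratfun K).

Definition ratcst (c : K) : ratfun K := polyfrac c%:P.

Fact cst_is_zmod_morphism : zmod_morphism ratcst.
Proof. by move=> x y; rewrite /ratcst /polyfrac polyCB rmorphB. Qed.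
Fact cst_is_monoid_morphism : monoid_morphism ratcst.
Proof. by split=> [|x y]; rewrite /ratcst /polyfrac ?polyCM ?rmorphM ?rmorph1. Qed.
HB.instance Definition _ :=
  GRing.isZmodMorphism.Build K (ratfun K) ratcst cst_is_zmod_morphism.
HB.instance Definition _ :=
  GRing.isMonoidMorphism.Build K (ratfun K) ratcst cst_is_monoid_morphism.

(* The monomials of degree at most [N] in [f] and [g], cleared of denominators,
   are [(N+1)^2] polynomials in a space of dimension linear in [N]. *)
Lemma ratfun_dependent f g : exists N (c : 'I_N.+1 * 'I_N.+1 -> K),
  (exists i, c i != 0) /\ \sum_i ratcst (c i) * (f ^+ i.1 * g ^+ i.2) = 0.
Proof.
have [n1 [d1 [d10 ->]]] := fraction_quotient f.
have [n2 [d2 [d20 ->]]] := fraction_quotient g.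
pose e := (size n1 + size d1 + size n2 + size d2)%N.
(* The cleared monomials have size at most [2 e N + 1], and [(N + 1)^2] exceeds this for the chosen
   [N]. *)
pose N := (2 * e).+1; exists N.
pose u (i : 'I_N.+1 * 'I_N.+1) :=
  n1 ^+ i.1 * d1 ^+ (N - i.1) * (n2 ^+ i.2 * d2 ^+ (N - i.2)).
have sX (p : {poly K}) k : (size p <= e)%N -> (size (p ^+ k) <= e * k + 1)%N.
  move=> pe; apply: leq_trans (size_poly_exp_leq _ _) _.
  by rewrite -addn1 leq_add2r leq_mul2r; apply/orP; right; lia.
have sM (p q : {poly K}) a b :
    (size p <= a + 1)%N -> (size q <= b + 1)%N -> (size (p * q)%R <= a + b + 1)%N.
  by move=> pa qb; apply: leq_trans (size_polyMleq _ _) _; lia.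
have su i : (size (u i) <= (e * N + e * N).+1)%N.
  have [li1 li2] : (i.1 <= N)%N /\ (i.2 <= N)%N by split; apply: leq_ord.
  have sk (p q : {poly K}) k : (size p <= e)%N -> (size q <= e)%N -> (k <= N)%N ->
      (size (p ^+ k * q ^+ (N - k)%N)%R <= e * N + 1)%N.
    move=> pe qe kN; have := sM _ _ _ _ (sX p k pe) (sX q (N - k)%N qe).
    by rewrite -mulnDr subnKC.
  have e4 : [/\ (size n1 <= e)%N, (size d1 <= e)%N, (size n2 <= e)%N & (size d2 <= e)%N].
    rewrite /e; move: (size n1) (size d1) (size n2) (size d2) => a b c d.
    by split; lia.
  by case: e4 => *; rewrite -addn1; apply: sM; apply: sk.
have [|c c0 cu] := poly_family_dependent su.
  by rewrite card_prod !card_ord /N; nia.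
exists c; split=> //.
have D0 : tofrac (d1 ^+ N * d2 ^+ N) != 0.
  by rewrite tofrac_eq0 mulf_neq0 ?expf_neq0.
have := congr1 (@tofrac _) cu; rewrite tofrac0 raddf_sum => cu'.
apply: (mulfI D0); rewrite mulr0 mulr_sumr; apply: etrans cu'.
apply: eq_bigr => i _; rewrite -mul_polyC /u /ratcst /polyfrac.
rewrite [RHS]/= !tofracM !tofracXn; apply: clear_denominators;
  by rewrite ?tofrac_eq0 ?leq_ord.
Qed.

End RationalFunctions.

(** * Traces on [K] of the primes of a valuation ring of [K(X)] *)

Section Contraction.
Local Open Scope classical_set_scope.
Local Open Scope ring_scope.

Section ValuationSums.
Variable K : fieldType.
Implicit Types (W : set K).

(** Divisibility in a valuation ring is total, so one member of a finite family divides all the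
    others; the same fact later makes finitely generated ideals principal. *)
Lemma valuation_max W (I : eqType) (x : I -> K) (s : seq I) :
  is_valuation_ring W -> (exists2 i, i \in s & x i != 0) ->
  exists k, [/\ k \in s, x k != 0 & forall l, l \in s -> W (x l / x k)].
Proof.
move=> [hW valW]; elim: s => [[]//|a s IH] hx.
have [/IH[k [sk xk kmax]]|s0] := pselect (exists2 i, i \in s & x i != 0); last first.
  have x0 i : i \in s -> x i = 0.
    by move=> si; apply/eqP; apply: contrapT => /negP xi; apply: s0; exists i.
  exists a; rewrite mem_head.
  case: hx => i; rewrite inE => /predU1P[->|/x0 ->]; last by rewrite eqxx.
  move=> xa; split=> // l; rewrite inE => /predU1P[->|/x0 ->].
    by rewrite mulfV //; apply: subring1.
  by rewrite mul0r; apply: subring0.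
have [xa|xa] := eqVneq (x a) 0.
  exists k; rewrite inE sk orbT; split=> // l; rewrite inE => /predU1P[->|/kmax//].
  by rewrite xa mul0r; apply: subring0.
have [Wa|Wk] := valW (x a / x k) (mulf_neq0 xa (invr_neq0 xk)).
  by exists k; rewrite inE sk orbT; split=> // l; rewrite inE => /predU1P[->|/kmax].
exists a; rewrite mem_head; split=> // l; rewrite inE => /predU1P[->|/kmax Wl].
  by rewrite mulfV //; apply: subring1.
have -> : x l / x a = (x l / x k) * (x a / x k)^-1 by field; rewrite xk xa.
exact: subringM.
Qed.

(* The terms of maximal value cannot cancel unless there are two of them. *)
Lemma valuation_sum0 W (I : finType) (x : I -> K) :
  is_valuation_ring W -> \sum_i x i = 0 -> (exists i, x i != 0) ->
  exists i j, [/\ i != j, x i != 0, x j != 0, W (x i / x j) & W (x j / x i)].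
Proof.
move=> hvW sum0 [i xi]; have [hW _] := hvW.
have [|k [_ xk kmax]] := @valuation_max W I x (enum I) hvW.
  by exists i => //; rewrite mem_enum.
apply: contrapT => nex; have hm := maxideal_prime hvW; have hmm := prime_submod hm.
have mx l : l != k -> maxideal W (x l / x k).
  move=> lk; apply: contrapT => /maxideal_inv[].
  rewrite mulf_eq0 invr_eq0 negb_or invf_div => /andP[xl _] Wkl; apply: nex.
  by exists l, k; split=> //; apply: kmax; rewrite mem_enum.
apply: (prime_not1 hm); rewrite -(opprK 1); apply: (submodN hW hmm).
have -> : - 1 = \sum_(l | l != k) x l / x k.
  rewrite -mulr_suml; move: sum0; rewrite (bigD1 k) //= => /eqP.
  by rewrite addrC addr_eq0 => /eqP ->; rewrite mulNr mulfV.
exact: (submod_sum _ hmm).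
Qed.

End ValuationSums.

Section Collapse.
Variables (L : fieldType) (W : set L) (Q : nat -> set L) (l i j : nat) (c f g : L).
Hypotheses (hvW : is_valuation_ring W) (hQ : prime_chain W Q l).
Hypotheses (ij : (i < j)%N) (jl : (j < l)%N).
Hypotheses (Qf : Q i.+1 f) (Qf' : ~ Q i f) (Qg : Q j.+1 g) (Qg' : ~ Q j g).
Hypotheses (c0 : c != 0) (Ci : Q i.+1 c -> Q i c) (Cj : Q j.+1 c -> Q j c).

(* If [f^a1 g^b1] and [f^a2 g^b2] had the same value up to a constant, that
   constant would lie in [Q i.+1] but not in [Q i], or in [Q j.+1] but not in
   [Q j]. *)
Lemma no_monomial_relation a1 b1 a2 b2 :
  (a1 < a2)%N \/ (a1 = a2 /\ (b1 < b2)%N) ->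
  let u := c * (f ^+ a1 * g ^+ b1) / (f ^+ a2 * g ^+ b2) in
  W u -> W u^-1 -> False.
Proof.
move=> hab; have [hW valW] := hvW.
have pQ k : (k <= l)%N -> is_prime_ideal W (Q k) by apply: prime_chain_prime.
have hi := pQ i (ltnW (ltn_trans ij jl)); have hj := pQ j (ltnW jl).
have hi1 := pQ i.+1 (leq_trans ij (ltnW jl)); have hj1 := pQ j.+1 jl.
have Qij : Q i.+1 `<=` Q j by apply: prime_chain_mono hQ ij (ltnW jl).
have Wf : W f by apply: prime_sub hi1 _ Qf.
have Wg : W g by apply: prime_sub hj1 _ Qg.
have f0 : f != 0 by apply: contra_notN Qf' => /eqP ->; apply: submod0 (prime_submod hi).
have g0 : g != 0 by apply: contra_notN Qg' => /eqP ->; apply: submod0 (prime_submod hj).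
case: hab => [lt_a|[-> lt_b]].
- rewrite /= (monomial_quotientl _ _ _ f0 g0 (ltnW lt_a)).
  case: (a2 - a1)%N {lt_a} (subn_gt0 a1 a2) (lt_a) => [|p] <- // _.
  rewrite invf_div; set u := c * _ / _; set v := _ / _ => Wu Wv.
  have Qfp : Q i.+1 (f ^+ p.+1 * g ^+ b2).
    rewrite exprS -mulrA mulrC; apply: (submodM (prime_submod hi1)) => //.
    by apply: subringM => //; apply: subringX.
  have Qfp' : ~ Q i (f ^+ p.+1 * g ^+ b2).
    apply: (primeM hi); do ?exact: subringX; first exact: primeX hi Wf Qf'.
    by apply: primeX hi Wg _ => // Qig; apply: Qg'; apply: prime_chain_mono hQ _ _ _ Qig;
      apply: ltnW.
  have eu : c * g ^+ b1 = u * (f ^+ p.+1 * g ^+ b2).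
    by rewrite divfK // mulf_neq0 ?expf_neq0.
  have ev : f ^+ p.+1 * g ^+ b2 = v * (c * g ^+ b1).
    by rewrite divfK // mulf_neq0 ?expf_neq0.
  have Qgb : ~ Q j (g ^+ b1) by apply: primeX hj Wg Qg'.
  (* The power [g ^+ b1] lies outside [Q j] while [f ^+ p.+1] lies inside, so the former divides the
     latter in [W]; this is where [i < j] enters. *)
  have Wd : W (c).
    have -> : c = u * g ^+ b2 * (f ^+ p.+1 / g ^+ b1).
      have gb0 : g ^+ b1 != 0 by rewrite expf_neq0.
      by apply: (mulIf gb0); rewrite -[RHS]mulrA divfK // eu [LHS]mulrA [LHS]mulrAC.
    apply: subringM => //; first by apply: subringM => //; apply: subringX.
    have := valW (f ^+ p.+1 / g ^+ b1).
    case; rewrite ?mulf_neq0 ?invr_eq0 ?expf_neq0 // invf_div => Wgf.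
    case: Qgb; rewrite -(divfK (expf_neq0 p.+1 f0) (g ^+ b1)).
    apply: (submodM (prime_submod hj)) => //; rewrite exprSr.
    apply: (submodM (prime_submod hj)); [exact: subringX|exact: Qij].
  have Qdg : Q i.+1 (c * g ^+ b1) by rewrite eu; apply: (submodM (prime_submod hi1)).
  have Qd : Q i.+1 (c).
    by have [//||//|/Qij] := prime_sub_or hi1 _ _ Qdg => //; apply: subringX.
  apply: Qfp'; rewrite ev; apply: (submodM (prime_submod hi)) => //.
  apply: (submodMr (prime_submod hi)); first exact: subringX.
  exact: Ci.
- rewrite /= (monomial_quotientr _ _ f0 g0 (ltnW lt_b)) invf_div.
  case: (b2 - b1)%N {lt_b} (subn_gt0 b1 b2) (lt_b) => [|p] <- // _.
  move=> Wu Wv; have Qd : Q j.+1 (c).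
    rewrite -(divfK (expf_neq0 p.+1 g0) (c)).
    apply: (submodM (prime_submod hj1)) => //; rewrite exprSr.
    by apply: (submodM (prime_submod hj1)) => //; apply: subringX.
  have Qgp : ~ Q j (g ^+ p.+1) by apply: primeX hj Wg Qg'.
  apply: Qgp; rewrite -(divfK c0 (g ^+ p.+1)).
  by apply: (submodM (prime_submod hj)) => //; apply: Cj.
Qed.

End Collapse.

Variable K : fieldType.
Implicit Types (W : set (ratfun K)) (Q : nat -> set (ratfun K)).

Definition csts W : set K := [set a | W (ratcst a)].

Lemma cst_neq0 (a : K) : (ratcst a != 0) = (a != 0).
Proof. by rewrite fmorph_eq0. Qed.

Lemma csts_subring W : is_subring W -> is_subring (csts W).
Proof.
move=> hW; split=> [|x y Wx Wy|x y Wx Wy]; rewrite /csts /=.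
- by rewrite rmorph1; apply: subring1.
- by rewrite rmorphB; apply: subringB.
- by rewrite rmorphM; apply: subringM.
Qed.

Lemma csts_valuation W : is_valuation_ring W -> is_valuation_ring (csts W).
Proof.
move=> [hW valW]; split; first exact: csts_subring.
by move=> x x0; rewrite /csts /= fmorphV; apply: valW; rewrite cst_neq0.
Qed.

Lemma csts_prime W (P : set (ratfun K)) : is_subring W ->
  is_prime_ideal W P -> is_prime_ideal (csts W) (csts P).
Proof.
move=> hW hP; have hPm := prime_submod hP; split.
- split; last by move=> x /(prime_sub hP).
  split=> [|x y Px Py|a x Wa Px]; rewrite /csts /=.
  + by rewrite rmorph0; apply: submod0 hPm.
  + by rewrite rmorphD; apply: (submodD hPm).
  + by rewrite rmorphM; apply: (submodM hPm).
- by rewrite /csts /= rmorph1; apply: prime_not1 hP.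
- by move=> x y Wx Wy; rewrite /csts /= rmorphM; apply: (prime_sub_or hP).
Qed.

Lemma csts_maxideal W : csts (maxideal W) = maxideal (csts W).
Proof.
apply/seteqP; split=> x; rewrite /csts /maxideal /= fmorphV.
  by case=> [/eqP|]; [rewrite fmorph_eq0 => /eqP; left|right].
by case=> [->|]; [rewrite rmorph0; left|right].
Qed.

(** An [f] jumping at step [i] and a [g] jumping at step [j] would have monomials of pairwise
    different values, even up to constants. But [f] and [g] are algebraically dependent over [K],
    and a vanishing sum has two terms of equal value. This is the rank form of Abhyankar's
    inequality in transcendence degree one. *)
Lemma prime_chain_one_collapse W Q l i j : is_valuation_ring W ->
  prime_chain W Q l -> (i < j)%N -> (j < l)%N ->
  csts (Q i.+1) `<=` csts (Q i) -> csts (Q j.+1) `<=` csts (Q j) -> False.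
Proof.
move=> hvW hQ ij jl Ci Cj.
have [/properE_exists[_ [f Qf Qf']] _] := hQ.2 i (ltn_trans ij jl).
have [/properE_exists[_ [g Qg Qg']] _] := hQ.2 j jl.
have [hW _] := hvW.
have f0 : f != 0.
  apply: contra_notN Qf' => /eqP ->.
  apply: submod0 (prime_submod (prime_chain_prime hW hQ _)).
  exact: ltnW (ltn_trans ij jl).
have g0 : g != 0.
  apply: contra_notN Qg' => /eqP ->.
  exact: submod0 (prime_submod (prime_chain_prime hW hQ (ltnW jl))).
have [N [c [[k ck] sum0]]] := ratfun_dependent f g.
have [|s [t [st xs xt Wst Wts]]] := valuation_sum0 hvW sum0.
  by exists k; apply: (monomial_neq0 _ _ _ f0 g0); rewrite cst_neq0.
have cs : c s != 0 by apply: contraNneq xs => ->; rewrite rmorph0 mul0r.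
have ct : c t != 0 by apply: contraNneq xt => ->; rewrite rmorph0 mul0r.
(* The exponents are compared lexicographically; exchanging the two terms if necessary puts the
   larger pair in the denominator. *)
have key (s' t' : 'I_N.+1 * 'I_N.+1) : c s' != 0 -> c t' != 0 ->
    let u := ratcst (c s') * (f ^+ s'.1 * g ^+ s'.2) / (ratcst (c t') * (f ^+ t'.1 * g ^+ t'.2)) in
    W u -> W u^-1 ->
    ~ ((s'.1 < t'.1)%N \/ (s'.1 = t'.1 :> nat /\ (s'.2 < t'.2)%N)).
  move=> cs' ct' u Wu Wu' hlt.
  have d0 : ratcst (c s' / c t') != 0 by rewrite cst_neq0 mulf_neq0 ?invr_eq0.
  have eu : ratcst (c s' / c t') * (f ^+ s'.1 * g ^+ s'.2) / (f ^+ t'.1 * g ^+ t'.2) = u.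
    by rewrite fmorph_div -mulrA mulf_div.
  apply: (no_monomial_relation hvW hQ ij jl Qf Qf' Qg Qg' d0 _ _ hlt).
  - exact: Ci.
  - exact: Cj.
  - by rewrite eu.
  - by rewrite eu.
have Wst' : W ((ratcst (c s) * (f ^+ s.1 * g ^+ s.2) /
    (ratcst (c t) * (f ^+ t.1 * g ^+ t.2)))^-1) by rewrite invf_div.
have Wts' : W ((ratcst (c t) * (f ^+ t.1 * g ^+ t.2) /
    (ratcst (c s) * (f ^+ s.1 * g ^+ s.2)))^-1) by rewrite invf_div.
have [lt1|lt1|eq1] := ltngtP s.1 t.1.
- by apply: (key s t) => //; left.
- by apply: (key t s) => //; left.
have [lt2|lt2|eq2] := ltngtP s.2 t.2.
- by apply: (key s t) => //; right.
- by apply: (key t s) => //; right.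
move: st; rewrite (surjective_pairing s) (surjective_pairing t).
by rewrite (val_inj eq1) (val_inj eq2) eqxx.
Qed.

Lemma prime_chain_csts W Q l : is_valuation_ring W -> prime_chain W Q l ->
  Q l = maxideal W ->
  exists P l', [/\ prime_chain (csts W) P l', P l' = maxideal (csts W) & (l <= l'.+1)%N].
Proof.
move=> hvW hQ Ql; have [hW _] := hvW.
have C0 : csts (Q 0%N) = [set 0].
  have [-> _] := hQ; apply/seteqP; split=> x; rewrite /csts /=.
    by move=> /eqP; rewrite fmorph_eq0 => /eqP.
  by move=> ->; rewrite rmorph0.
have Cp k : (k <= l)%N -> is_prime_ideal (csts W) (csts (Q k)).
  by move=> kl; apply: csts_prime => //; apply: prime_chain_prime hQ kl.
have CS k : (k < l)%N -> csts (Q k) `<=` csts (Q k.+1).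
  by move=> kl x; have [/properW QQ _] := hQ.2 k kl; apply: QQ.
have [[i [il Ci]]|nocoll] :=
    pselect (exists i, (i < l)%N /\ csts (Q i.+1) `<=` csts (Q i)); last first.
  exists (fun k => csts (Q k)), l; rewrite leqnSn Ql csts_maxideal; split=> //.
  split=> // k kl; split; last exact: Cp.
  by split; [exact: CS|move=> Ck; apply: nocoll; exists k].
case: l => [|l'] in hQ Ql Cp CS il *; first by [].
have strict k : (k <= l')%N -> k <> i -> csts (Q k) `<` csts (Q k.+1).
  move=> kl ki; split; first exact: CS.
  move=> Ck; have [lt_ki|lt_ik|//] := ltngtP k i.
    exact: (prime_chain_one_collapse hvW hQ lt_ki il Ck Ci).
  exact: (prime_chain_one_collapse hvW hQ lt_ik kl Ci Ck).
have eqi : csts (Q i.+1) = csts (Q i) by apply/seteqP; split=> //; apply: CS.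
have bl k : (k <= i)%N -> bump i.+1 k = k by move=> ki; rewrite /bump ltnNge ki.
have bg k : (i < k)%N -> bump i.+1 k = k.+1 by move=> ik; rewrite /bump ik.
(* [bump i.+1] skips the index [i.+1], whose trace repeats that of index [i]. *)
exists (fun k => csts (Q (bump i.+1 k))), l'; split=> //; last first.
  (* If the repetition is at the very end, the index dropped is the last one, and the trace at [i]
     is still the maximal ideal. *)
  have [li|il'] := leqP l' i; last by rewrite bg // Ql csts_maxideal.
  have -> : l' = i by lia.
  by rewrite bl // -eqi -csts_maxideal -Ql; congr (csts (Q _)); lia.
split=> [|k kl]; first by rewrite bl.
split; last by apply: Cp; case: (leqP k.+1 i) => [/bl ->|/bg ->]; lia.
have [ki|ik|eki] := ltngtP k i.
- by rewrite !bl ?(ltnW ki) //; apply: strict; lia.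
- by rewrite !bg ?(leqW ik) //; apply: strict; lia.
- by rewrite bl ?bg ?eki // -eqi; apply: strict; lia.
Qed.

End Contraction.

(** * Quasi-primes and linked overrings *)

Section Semistar.
Local Open Scope classical_set_scope.
Local Open Scope ring_scope.
Variables (K : fieldType) (D : set K) (star : set K -> set K).
Implicit Types (T V E F I M P Q : set K).

(** For such [F], the condition [star F 1] amounts to [star F = star D] ([fg_star1]), the hypothesis
    of linkedness. [P] may be a prime of any overring, as only its trace on [D] is tested. *)
Definition avoids P : Prop :=
  forall F, fg_submodules D F -> F `<=` D -> star F 1 -> ~ F `<=` P.

Lemma avoidsS P Q : P `<=` Q -> avoids Q -> avoids P.
Proof. by move=> PQ hQ F hF FD F1 FP; apply: (hQ F) => // x /FP/PQ. Qed.

Lemma avoids0 : avoids [set 0].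
Proof. by move=> F [[_ [x Fx x0]] _] _ _ /(_ x Fx) x00; rewrite x00 eqxx in x0. Qed.

Lemma fg_nonzero F : fg_submodules D F -> nonzero_submodules D F.
Proof. by case. Qed.

Hypothesis hD : is_subring D.

Lemma fg_spanP F : fg_submodules D F -> exists2 s : seq K,
  F = module_span D s & exists2 x, x \in s & x != 0.
Proof.
move=> [[_ [x Fx x0]] [s defF]]; exists s => //; apply: contrapT => s0.
suff : [set 0] x by move=> /eqP; apply/negP.
move: Fx; rewrite defF; apply: span_min; first exact: prime_submod (prime0 hD).
by move=> y ys; apply: contrapT => /eqP y0; apply: s0; exists y.
Qed.

Lemma fg_join E F G : is_submodule D E -> fg_submodules D F -> fg_submodules D G ->
  F `<=` E -> G `<=` E ->
  exists H, [/\ fg_submodules D H, H `<=` E, F `<=` H & G `<=` H].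
Proof.
move=> hE /fg_spanP[s -> [x xs x0]] /fg_spanP[t -> _] sE tE.
exists (module_span D (s ++ t)); split.
- by apply: (fg_span hD _ x0); rewrite mem_cat xs.
- apply: span_min => // y; rewrite mem_cat => /orP[] yst.
    by apply: sE; apply: mem_span.
  by apply: tE; apply: mem_span.
- apply: span_min; first exact: span_submodule.
  by move=> y ys; apply: mem_span => //; rewrite mem_cat ys.
- apply: span_min; first exact: span_submodule.
  by move=> y ys; apply: mem_span => //; rewrite mem_cat ys orbT.
Qed.

Hypothesis hstar : is_semistar D star.

Let nz E := exists2 x : K, E x & x != 0.

Lemma star_submodule E : nonzero_submodules D E -> is_submodule D (star E).
Proof. by case: hstar => h _ _ _ /h[]. Qed.

Lemma star_mono E F : nonzero_submodules D E -> nonzero_submodules D F ->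
  E `<=` F -> star E `<=` star F.
Proof. by case: hstar => _ _ h _; apply: h. Qed.

Lemma star_ext E : nonzero_submodules D E -> E `<=` star E.
Proof. by case: hstar => _ _ _ h /h[]. Qed.

Lemma star_closed E F : nonzero_submodules D E -> nonzero_submodules D F ->
  E `<=` star F -> star E `<=` star F.
Proof.
move=> hE hF EF; have [h1 _ _ h4] := hstar; have [_ <-] := h4 F hF.
by apply: star_mono => //; apply: h1.
Qed.

Lemma fg_star1 F : fg_submodules D F -> F `<=` D ->
  star F 1 <-> star F = star D.
Proof.
move=> [hF _] FD; have hDD : nonzero_submodules D D by apply: subring_overring.
split=> [F1|->]; last by apply: star_ext => //; apply: subring1.
apply/seteqP; split; first exact: star_mono.
by apply: star_closed => //; apply: submod1 => //; apply: star_submodule.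
Qed.

(** The finitely generated submodules of [E] are directed. This is the finite character of [star_f],
    from which its values are submodules and, in [star_f_closed], its idempotence on finitely
    generated pieces follows. *)
Lemma star_f_finite E (s : seq K) : nonzero_submodules D E ->
  (forall x, x \in s -> star_f D star E x) ->
  exists G, [/\ fg_submodules D G, G `<=` E & forall x, x \in s -> star G x].
Proof.
move=> [hE [z Ez z0]]; elim: s => [|a s IH] hs.
  exists (module_span D [:: z]); split=> //; first exact: fg_span hD (mem_head _ _) z0.
  by apply: span_min => // x; rewrite inE => /eqP ->.
have [|G [hG GE sG]] := IH; first by move=> x xs; apply: hs; rewrite inE xs orbT.
have [F [hF FE] Fa] := hs a (mem_head _ _).
have [H [hH HE FH GH]] := fg_join hE hF hG FE GE.
exists H; split=> // x; rewrite inE => /predU1P[->|/sG].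
  exact: (star_mono (fg_nonzero hF) (fg_nonzero hH) FH).
exact: (star_mono (fg_nonzero hG) (fg_nonzero hH) GH).
Qed.

Lemma star_f_ext E : nonzero_submodules D E -> E `<=` star_f D star E.
Proof.
move=> [hE [z Ez z0]] x Ex; exists (module_span D [:: x; z]).
  split; first by apply: fg_span hD _ z0; rewrite !inE eqxx orbT.
  by apply: span_min => // y; rewrite !inE => /orP[] /eqP ->.
apply: star_ext; last by apply: mem_span; rewrite ?mem_head.
by have [] := fg_span hD (_ : z \in [:: x; z]) z0; rewrite ?inE ?eqxx ?orbT.
Qed.

Lemma star_f_submodule E : nonzero_submodules D E -> is_submodule D (star_f D star E).
Proof.
move=> hE; have comb x y a b : D a -> D b -> star_f D star E x -> star_f D star E y ->
    star_f D star E (a * x + b * y).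
  move=> Da Db Ex Ey; have [|G [hG GE sG]] := @star_f_finite E [:: x; y] hE.
    by move=> z; rewrite !inE => /orP[] /eqP ->.
  have hm : is_submodule D (star G) by apply: star_submodule; case: hG.
  exists G => //; apply: (submodD hm); apply: (submodM hm) => //; apply: sG;
    by rewrite !inE eqxx ?orbT.
have D1 := subring1 hD; have D0 := subring0 hD.
split.
- by apply: star_f_ext => //; apply: submod0 (proj1 hE).
- by move=> x y Ex Ey; have := comb x y 1 1 D1 D1 Ex Ey; rewrite !mul1r.
- move=> a x Da Ex; have := comb x x a 0 Da D0 Ex Ex; rewrite mul0r addr0 //.
Qed.

Lemma star_f_closed E F : nonzero_submodules D E -> fg_submodules D F ->
  F `<=` star_f D star E -> star F `<=` star_f D star E.
Proof.
move=> hE hF FE; have [s defF _] := fg_spanP hF.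
have [|G [hG GE sG]] := @star_f_finite E s hE.
  by move=> x xs; apply: FE; rewrite defF; apply: mem_span.
move=> x Fx; exists G => //; have [hGn _] := hG; have [hFn _] := hF.
apply: star_closed Fx => //; rewrite defF; apply: span_min => //.
exact: star_submodule.
Qed.

Definition star_closure I := star_f D star I `&` D.

Section Closure.
Variable I : set K.
Hypotheses (hI : is_ideal D I) (nzI : nz I) (avI : avoids I).

Let hIn : nonzero_submodules D I. Proof. by split=> //; case: hI. Qed.

Lemma sub_star_closure : I `<=` star_closure I.
Proof. by move=> x Ix; split; [apply: star_f_ext|case: hI => _; apply]. Qed.

Lemma star_closure_ideal : is_ideal D (star_closure I).
Proof.
split; last by move=> x [].
apply: submod_setI; first exact: star_f_submodule.
exact: submod_subring.
Qed.

Lemma star_closure_nz : nz (star_closure I).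
Proof. by have [x Ix x0] := nzI; exists x => //; apply: sub_star_closure. Qed.

Lemma star_closure_avoids : avoids (star_closure I).
Proof.
move=> F hF FD F1 Fc; have [|G [hG GI] G1] := @star_f_closed I F hIn hF _ 1 F1.
  by move=> x /Fc[].
by apply: (avI hG) => // x /GI; case: hI => _; apply.
Qed.

Lemma star_closure_quasi : is_quasi_ideal D (star_f D star) (star_closure I).
Proof.
have hc := star_closure_ideal; have [hcm _] := hc.
split=> //; first by split=> //; apply: star_closure_nz.
apply/seteqP; split=> x.
  move=> [[F [hF Fc] Fx] Dx]; split=> //.
  by apply: star_f_closed Fx => // y /Fc[].
move=> cx; split; last by case: cx.
by apply: star_f_ext => //; split=> //; apply: star_closure_nz.
Qed.

Lemma star_closure_proper : star_closure I <> D.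
Proof.
move=> eD; have [x0 Ix0 nz0] := nzI.
have D1 := subring1 hD.
apply: (star_closure_avoids (F := module_span D [:: 1])).
- by apply: fg_span hD (mem_head _ _) _; apply: oner_neq0.
- by apply: span_min => [|y]; [apply: submod_subring|rewrite inE => /eqP ->].
- apply: star_ext; last by apply: mem_span; rewrite ?mem_head.
  by have [] := fg_span hD (mem_head 1 [::]) (oner_neq0 K).
- rewrite eD; apply: span_min => [|y]; first exact: submod_subring.
  by rewrite inE => /eqP ->.
Qed.

(** The sets [F] being finitely generated, avoidance survives unions of chains, and Zorn's lemma
    gives a maximal avoiding ideal [M]. Its closure avoids as well, hence equals [M]; since every
    proper quasi-ideal avoids, [M] is maximal among them. *)
Lemma avoids_in_QMax : exists2 M, QMax D (star_f D star) M & I `<=` M.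
Proof.
pose Pr J := is_ideal D J /\ avoids J.
have [//|F Fn0 FPr Ftot|M [[hM avM] IM Mmax]] := @Zorn_above _ Pr I.
  have cov := chain_finite_cover Fn0 Ftot; split.
    split; last by move=> x [J /FPr[[_ JD] _] /JD].
    split.
    + by have [J FJ] := Fn0; exists J => //; have [[hJ _] _] := FPr _ FJ; apply: submod0 hJ.
    + move=> x y [J FJ Jx] [J' FJ' Jy]; have [z|H FH Hs] := cov [:: x; y].
        by rewrite !inE => /orP[] /eqP ->; [exists J|exists J'].
      have [[hH _] _] := FPr _ FH; exists H => //.
      by apply: (submodD hH); apply: Hs; rewrite !inE eqxx ?orbT.
    + move=> a x Da [J FJ Jx]; exists J => //.
      by have [[hJ _] _] := FPr _ FJ; apply: (submodM hJ).
  move=> G hG GD G1 GU; have [s defG _] := fg_spanP hG.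
  have [x xs|H FH Hs] := cov s.
    have /GU[J FJ Jx] : G x by rewrite defG; apply: mem_span.
    by exists J.
  have [[hH _] avH] := FPr _ FH; apply: (avH G) => //.
  by rewrite defG; apply: span_min.
have nzM : nz M by have [x Ix x0] := nzI; exists x => //; apply: IM.
have hMn : nonzero_submodules D M by split=> //; case: hM.
exists M => //.
have quasi_avoids J : is_quasi_ideal D (star_f D star) J -> J <> D -> avoids J.
  move=> [[hJ JD] hJn eJ] nJD F hF FD F1 FJ; apply: nJD; apply/seteqP; split=> //.
  by apply: submod1 => //; rewrite -eJ; split; [exists F|apply: subring1].
split.
- have hc : Pr (star_f D star M `&` D).
    split; last first.
      move=> F hF FD F1 Fc; have [|G [hG GM] G1] := @star_f_closed M F hMn hF _ 1 F1.
        by move=> x /Fc[].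
      by apply: (avM G) => // x /GM; case: hM => _; apply.
    split; last by move=> x [].
    by apply: submod_setI; [apply: star_f_submodule|apply: submod_subring].
  split=> //; apply: Mmax => // x Mx; split; last by case: hM => _; apply.
  exact: star_f_ext.
- move=> MD; apply: (avM (module_span D [:: 1])).
  + by apply: fg_span hD (mem_head _ _) _; apply: oner_neq0.
  + apply: span_min => [|y]; first exact: submod_subring.
    by rewrite inE => /eqP ->; apply: subring1.
  + apply: star_ext; last by apply: mem_span; rewrite ?mem_head.
    by have [] := fg_span hD (mem_head 1 [::]) (oner_neq0 K).
  + rewrite MD; apply: span_min => [|y]; first exact: submod_subring.
    by rewrite inE => /eqP ->; apply: subring1.
- move=> J hJ nJD MJ; apply: Mmax => //; split; first by case: hJ.
  exact: quasi_avoids.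
Qed.

End Closure.

Lemma QMax_avoids M : QMax D (star_f D star) M -> avoids M.
Proof.
move=> [[[hM MD] hMn eM] nMD _] F hF FD F1 FM; apply: nMD; apply/seteqP; split=> //.
by apply: submod1 => //; rewrite -eM; split; [exists F|apply: subring1].
Qed.

(** Let [x y] be in [M] and [J = M + D x]. If [J] avoids, its closure is a proper quasi-ideal, so
    [x] is in [M]. Otherwise [J] contains some [F] with [1] in [star F]; then [y F] lies in [M] and
    [y] in [star (y F)], so [y] is in [M]. *)
Lemma QMax_prime M : QMax D (star_f D star) M -> is_prime_ideal D M.
Proof.
move=> hM; have avM := QMax_avoids hM; have [[hMi hMn eM] nMD Mmax] := hM.
have [hMm MD] := hMi; split=> //.
  by move=> M1; apply: nMD; apply/seteqP; split=> //; apply: submod1.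
move=> x y Dx Dy Mxy; apply: contrapT => /not_orP[nMx nMy].
pose J := [set z | exists m d, [/\ M m, D d & z = m + d * x]].
have MJ : M `<=` J by move=> m Mm; exists m, 0; rewrite mul0r addr0; split=> //; apply: subring0.
have hJ : is_ideal D J.
  split; last first.
    move=> _ [m [d [Mm Dd ->]]]; apply: subringD => //; first exact: MD.
    exact: subringM.
  split; first by apply: MJ; apply: submod0 hMm.
    move=> _ _ [m [d [Mm Dd ->]]] [m' [d' [Mm' Dd' ->]]].
    exists (m + m'), (d + d'); split; [exact: (submodD hMm)|exact: subringD|ring].
  move=> a _ Da [m [d [Mm Dd ->]]].
  exists (a * m), (a * d); split; [exact: (submodM hMm)|exact: subringM|ring].
have nzJ : nz J by have [_ [z Mz z0]] := hMn; exists z => //; apply: MJ.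
have Jx : J x by exists 0, 1; rewrite mul1r add0r; split=> //; [apply: submod0 hMm|apply: subring1].
have [avJ|] := pselect (avoids J).
  apply: nMx; rewrite -(Mmax (star_closure J)).
  - exact: sub_star_closure.
  - exact: star_closure_quasi.
  - exact: star_closure_proper.
  - by move=> z /MJ; apply: sub_star_closure.
move=> /existsNP[F /not_implyP[hF /not_implyP[FD /not_implyP[F1 /contrapT FJ]]]].
have y0 : y != 0 by apply: contra_notN nMy => /eqP ->; apply: submod0 hMm.
apply: nMy; rewrite -eM; split=> //; have [s defF [z zs z0]] := fg_spanP hF.
exists [set y * e | e in F]; last first.
  have [_ sc _ _] := hstar; rewrite sc //; last exact: fg_nonzero hF.
  by exists 1; rewrite ?mulr1.
split; last first.
  move=> _ [f /FJ[m [d [Mm Dd ->]]] <-].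
  have -> : y * (m + d * x) = y * m + d * (x * y) by ring.
  by apply: (submodD hMm); apply: (submodM hMm).
split; last first.
  exists [seq y * e | e <- s]; rewrite -/(module_span D _) defF; apply/seteqP; split.
    move=> _ [e se <-]; move: e se.
    suff : module_span D s `<=` [set e | module_span D [seq y * e | e <- s] (y * e)] by [].
    have hs := span_submodule [seq y * e | e <- s] hD.
    apply: span_min => [|e es] /=; last by apply: mem_span => //; apply: map_f.
    split=> [|e e' he he'|a e Da he] /=.
    - by rewrite mulr0; apply: submod0 hs.
    - by rewrite mulrDr; apply: (submodD hs).
    - by rewrite mulrCA; apply: (submodM hs).
  apply: span_min; first by apply: submod_scale => //; apply: span_submodule.
  by move=> _ /mapP[e es ->]; exists e => //; apply: mem_span.
split; first by apply: submod_scale => //; case: hF => -[].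
by exists (y * z); [exists z => //; rewrite defF; apply: mem_span|rewrite mulf_neq0].
Qed.

Lemma avoids_witness M F : QMax D (star_f D star) M -> fg_submodules D F ->
  F `<=` D -> star F 1 -> exists2 a, F a & ~ M a.
Proof.
move=> /QMax_avoids avM hF FD F1; have := avM F hF FD F1.
by move=> /existsNP[a /not_implyP[Fa Ma]]; exists a.
Qed.

Hypothesis hquot : forall x : K, exists a b, [/\ D a, D b, b != 0 & x = a / b].

Lemma overring_contract_nz T Q : D `<=` T -> is_submodule T Q -> nz Q -> nz (Q `&` D).
Proof.
move=> DT hQ [x Qx x0]; have [a [b [Da Db b0 ex]]] := hquot x.
have ea : b * x = a by rewrite ex mulrC divfK.
exists a; last by rewrite -ea mulf_neq0.
by split=> //; rewrite -ea; apply: (submodM hQ) => //; apply: DT.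
Qed.

Lemma avoids_contract_QMax T Q : is_subring T -> D `<=` T -> is_prime_ideal T Q ->
  nz Q -> avoids Q -> exists2 M, QMax D (star_f D star) M & Q `&` D `<=` M.
Proof.
move=> hT DT hQ nzQ avQ; have [hQD _ _] := prime_setI hD DT hQ.
apply: avoids_in_QMax hQD _ _; last by apply: avoidsS avQ => x [].
exact: overring_contract_nz (prime_submod hQ) nzQ.
Qed.

(** If [Q] contains an [F] with [1] in [star F], then [F] leaves every quasi-maximal [M], so [1] is
    in every [Q D_M]. Conversely the trace of an avoiding [Q] lies in some [M], and then the
    elements of [D] outside [M] are outside [Q], so [Q D_M] meets [T] in [Q]. *)
Lemma quasi_tilde_primeP T Q : is_subring T -> D `<=` T ->
  is_quasi_prime T (tilde D star) Q <->
  [/\ is_prime_ideal T Q, nz Q & avoids Q].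
Proof.
move=> hT DT; split.
  move=> [[_ [hQm nzQ] eQ] hQ]; split=> // F hF FD F1 FQ.
  apply: (prime_not1 hQ); rewrite -eQ; split; last exact: subring1.
  move=> M hM; have [a Fa Ma] := avoids_witness hM hF FD F1.
  rewrite prod_localization //; last exact: submodW DT hQm.
    by exists a; split=> //; [apply: FD|rewrite mulr1; apply: FQ].
  exact: QMax_prime.
move=> [hQ nzQ avQ]; split=> //; have hQm := prime_submod hQ.
split; [by case: hQ|by []|].
have [M hM QM] := avoids_contract_QMax hT DT hQ nzQ avQ.
apply/seteqP; split=> x.
  move=> [tx Tx]; have := tx M hM; rewrite prod_localization //.
  - move=> [s [Ds Ms Qsx]]; have [//|Qs|//] := prime_sub_or hQ _ Tx Qsx; first exact: DT.
    by case: Ms; apply: QM.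
  - exact: QMax_prime.
  - exact: submodW DT hQm.
move=> Qx; split; last exact: prime_sub hQ _ Qx.
move=> N hN; have hNp := QMax_prime hN.
apply: prod_mod_sub Qx; apply: localization_sub => //; exact: subring1.
Qed.

(** When the centre lies in a quasi-maximal [M], elements of [D] outside [M] are units of [V], so
    that [F D_M] is contained in [F V]. *)
Lemma tilde_valuationP V :
  is_star_valuation_overring D (tilde D star) V <->
  [/\ is_valuation_ring V, D `<=` V & avoids (maxideal V)].
Proof.
split.
  move=> [[[hV DV] valV] tV]; split=> // F hF FD F1 Fm.
  have hm := @maxideal_prime _ V (conj hV valV); apply: (prime_not1 hm).
  have : prod_mod F V 1.
    apply: tV => // M hM; have [a Fa Ma] := avoids_witness hM hF FD F1.
    rewrite prod_localization //; [|exact: QMax_prime|by case: hF => -[]].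
    by exists a; split=> //; [apply: FD|rewrite mulr1].
  by apply: prod_mod_min => //; apply: prime_submod.
move=> [[hV valV] DV avV]; split=> // F hF x tFx.
have hm := @maxideal_prime _ V (conj hV valV).
have [nzm|zm] := pselect (nz (maxideal V)).
  have [M hM mM] := avoids_contract_QMax hV DV hm nzm avV.
  have := tFx M hM; rewrite prod_localization //; [|exact: QMax_prime|by case: hF => -[]].
  move=> [s [Ds Ms Fsx]].
  have /maxideal_inv[s0 Vs] : ~ maxideal V s by move=> ms; apply: Ms; apply: mM.
  have -> : x = s * x / s by rewrite [s * x]mulrC mulfK.
  exact: prod_mod_mul.
(* A zero maximal ideal means [V = K]; then [F V = K] because [F] is nonzero. *)
have Vall y : V y.
  have [->|y0] := eqVneq y 0; first exact: subring0.
  apply: contrapT => Vy; apply: zm; exists y^-1; last by rewrite invr_eq0.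
  by right; rewrite invrK.
have [[_ [z Fz z0]] _] := hF.
by have -> : x = z * (z^-1 * x); [rewrite mulVKf|apply: prod_mod_mul].
Qed.

(** An [F] inside [Q] with [1] in [star F] extends to [F T] inside [Q] with [1] in [star' (F T)].
    The form covers both an arbitrary [star'] with a quasi-maximal ideal [Q] and [w_op T] with a
    quasi-prime [Q]. *)
Lemma linked_avoids T star' Q : is_subring T -> D `<=` T ->
  is_linked D star T star' -> is_submodule T Q -> ~ Q 1 ->
  (forall E, nonzero_submodules T E -> E `<=` star' E) ->
  (forall F, fg_submodules T F -> F `<=` Q -> star' F 1 -> False) ->
  avoids Q.
Proof.
move=> hT DT lk hQ Q1 ext' fgQ F hF FD F1 FQ.
have [s defF [z zs z0]] := fg_spanP hF.
apply: (fgQ (prod_mod F T)).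
- by rewrite defF prod_mod_span //; apply: fg_span zs z0.
- exact: prod_mod_min.
- rewrite (lk F) //; last by apply/fg_star1.
  by apply: ext'; [apply: subring_overring|apply: subring1].
Qed.

(** Linkedness concerns [star'] and not its tilde. The bridge is a quasi-maximal [N] containing [Q]:
    without one, [1] would lie in every [Q T_N], hence in [Q]. *)
Lemma linked_tilde_avoids T star' Q : is_subring T -> D `<=` T ->
  is_linked D star T star' ->
  (forall E, nonzero_submodules T E -> E `<=` star' E) ->
  is_quasi_prime T (tilde T star') Q -> avoids Q.
Proof.
move=> hT DT lk ext' [[_ _ eQ] hQ].
have [N hN Q1] : exists2 N, QMax T (star_f T star') N &
    ~ prod_mod Q (localization T N) 1.
  apply: contrapT => nN; apply: (prime_not1 hQ); rewrite -eQ.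
  split; last exact: subring1.
  by move=> N hN; apply: contrapT => Q1; apply: nN; exists N.
have [[[hNm NT] _ eN] nNT _] := hN.
have N1 : ~ N 1 by move=> N1; apply: nNT; apply/seteqP; split=> //; apply: submod1.
have QN : Q `<=` N.
  move=> x Qx; apply: contrapT => Nx; apply: Q1.
  have x0 : x != 0 by apply: contra_notN Nx => /eqP ->; apply: submod0 hNm.
  rewrite -(mulfV x0); apply: prod_mod_mul => //.
  by apply: localization_inv => //; apply: prime_sub hQ _ Qx.
apply: avoidsS QN _; apply: (linked_avoids (T := T) (star' := star')) => //.
move=> F hF FN F1; apply: N1; rewrite -eN; split; last exact: subring1.
by exists F.
Qed.

End Semistar.

(** * Operations on overrings that realize given chains: localization and the [w] operation *)

Section LocalOperations.
Local Open Scope classical_set_scope.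
Local Open Scope ring_scope.
Variable K : fieldType.
Implicit Types (D T V E F I M P Q : set K) (star : set K -> set K).

(** Since [Q] lies in the prime [N], already [Q T_N] meets [T] in [Q]; one quasi-maximal prime thus
    makes the whole chain below it count. *)
Lemma quasi_tilde_prime_sub T star N Q : is_subring T -> is_prime_ideal T N ->
  QMax T (star_f T star) N -> is_prime_ideal T Q -> (exists2 x, Q x & x != 0) ->
  Q `<=` N -> is_quasi_prime T (tilde T star) Q.
Proof.
move=> hT hN hNm hQ nzQ QN; have hQm := prime_submod hQ.
split=> //; split; [by case: hQ|by []|].
apply/seteqP; split=> x.
  move=> [tx Tx]; have := tx N hNm; rewrite prod_localization //.
  by move=> [s [Ts Ns Qsx]]; have [/QN|] := prime_sub_or hQ Ts Tx Qsx.
move=> Qx; split; last exact: prime_sub hQ _ Qx.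
move=> M [[[hM MT] _ _] nMT _]; apply: prod_mod_sub Qx.
exists 1, 1; rewrite divr1; split=> //; do ?exact: subring1.
by move=> M1; apply: nMT; apply/seteqP; split=> //; apply: submod1.
Qed.

(** The test operation for the lower estimates: it is linked to [star] as soon as [Q] avoids, and a
    nonzero prime [Q] is quasi-maximal for it. *)
Definition loc_op T Q : set K -> set K := fun E => prod_mod E (localization T Q).

Lemma loc_op_semistar T Q : is_subring T -> is_prime_ideal T Q ->
  is_semistar T (loc_op T Q).
Proof.
move=> hT hQ; have hL := localization_subring hT hQ.
have TL := localization_sub hT hQ; have L1 := subring1 hL.
split.
- move=> E [hE [x Ex x0]]; split.
    by apply: submodW TL _; apply: prod_mod_submodule.
  by exists x => //; apply: prod_mod_sub.
- move=> x E x0 [hE _]; rewrite /loc_op !prod_localization //; last exact: submod_scale.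
  apply/seteqP; split=> [y [s [Ts Qs [e Ee ese]]]|_ [y [s [Ts Qs Ey]] <-]].
    exists (y / x); last by rewrite mulrC divfK.
    exists s; split=> //; rewrite mulrA -ese mulrAC mulfV ?mul1r //.
  by exists s; split=> //; exists (s * y) => //; rewrite mulrCA.
- by move=> E F _ _ EF; apply: prod_modS.
- move=> E [hE _]; split; first exact: prod_mod_sub.
  apply/seteqP; split; last exact: prod_mod_sub.
  by apply: prod_mod_min; first exact: prod_mod_submodule.
Qed.

Lemma loc_op_QMax T Q : is_subring T -> is_prime_ideal T Q ->
  (exists2 x, Q x & x != 0) -> QMax T (star_f T (loc_op T Q)) Q.
Proof.
move=> hT hQ nzQ; have hQm := prime_submod hQ; have [hQi Q1 _] := hQ.
have hls := loc_op_semistar hT hQ.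
split.
- split=> //; apply/seteqP; split=> x.
    move=> [[F [[[hF _] _] FQ]]]; rewrite /loc_op prod_localization //.
    move=> [s [Ts Qs /FQ Fsx]] Tx.
    by have [] := prime_sub_or hQ Ts Tx Fsx.
  by move=> Qx; split; [apply: (star_f_ext hT hls)|apply: prime_sub hQ _ Qx].
- exact: prime_neq.
- move=> I [[hI IT] hIn eI] nIT QI; apply/seteqP; split=> // x Ix.
  apply: contrapT => Qx; apply: nIT; apply/seteqP; split=> //.
  apply: submod1 => //; rewrite -eI; split; last exact: subring1.
  have x0 : x != 0 by apply: contra_notN Qx => /eqP ->; apply: submod0 hQm.
  exists (module_span T [:: x]).
    split; first exact: fg_span (mem_head _ _) x0.
    by apply: span_min => // y; rewrite inE => /eqP ->.
  rewrite /loc_op prod_localization //; last exact: span_submodule.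
  exists x; split=> //; first exact: IT.
  by rewrite mulr1; apply: mem_span; rewrite ?mem_head.
Qed.

Lemma loc_op_linked D star T Q : is_subring D -> is_semistar D star ->
  is_subring T -> D `<=` T -> is_prime_ideal T Q -> avoids D star Q ->
  is_linked D star T (loc_op T Q).
Proof.
move=> hD hstar hT DT hQ avQ F hF FD /(fg_star1 hD hstar hF FD) F1.
have hL := localization_subring hT hQ.
have /existsNP[a /not_implyP[Fa Qa]] := avQ F hF FD F1.
have Ta : T a by apply: DT; apply: FD.
have a0 : a != 0 by apply: contra_notN Qa => /eqP ->; apply: submod0 (prime_submod hQ).
apply/seteqP; split.
  apply: prod_modS => //; apply: prod_mod_min => [|x /FD/DT//].
  exact: submod_subring.
apply: prod_mod_min => [|x Tx]; first exact: prod_mod_submodule.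
have -> : x = (a * x) * a^-1 by rewrite mulrAC mulfV ?mul1r.
by apply: prod_mod_mul; [apply: prod_mod_mul|apply: localization_inv].
Qed.

(** A finitely generated ideal of [V] is generated by its member [k] dividing all generators, so its
    [v]-closure adds nothing. *)
Lemma valuation_w_QMax V : is_valuation_ring V -> (exists2 x, maxideal V x & x != 0) ->
  QMax V (star_f V (v_op V)) (maxideal V).
Proof.
move=> hvV nzm; have [hV valV] := hvV; have hm := maxideal_prime hvV.
have hmm := prime_submod hm; split.
- split=> //; first by case: hm.
  apply/seteqP; split=> x.
    move=> [[F [hF Fm] vFx] Vx].
    have [s defF hs] := fg_spanP hV hF.
    have [k [sk k0 kmax]] := @valuation_max _ V _ id s hvV hs.
    have mk : maxideal V k by apply: Fm; rewrite defF; apply: mem_span.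
    have -> : x = (x * k^-1) * k by rewrite divfK.
    apply: (submodM hmm) => //; apply: vFx => e; rewrite defF => se.
    move: e se; apply: span_min => [|e es]; last by rewrite mulrC; apply: kmax.
    split=> [|e e' he he'|a e Va he]; rewrite ?mulr0 ?mulrDr.
    + exact: subring0.
    + exact: subringD.
    + by rewrite mulrCA; apply: subringM.
  move=> mx; split; last exact: maxideal_sub.
  have [z mz z0] := nzm; exists (module_span V [:: x; z]).
    split; first by apply: (fg_span hV _ z0); rewrite !inE eqxx orbT.
    by apply: span_min => // y; rewrite !inE => /orP[] /eqP ->.
  move=> c cV; rewrite mulrC; apply: cV; apply: mem_span => //; exact: mem_head.
- exact: prime_neq.
- move=> I [[hI IV] _ _] nIV mI; apply/seteqP; split=> // x Ix.
  apply: contrapT => /maxideal_inv[x0 Vx]; apply: nIV; apply/seteqP; split=> //.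
  by apply: submod1 => //; rewrite -(mulVf x0); apply: (submodM hI).
Qed.

Lemma w_op_mono T E F : E `<=` F -> w_op T E `<=` w_op T F.
Proof. by move=> EF x wx N hN; apply: prod_modS (wx N hN). Qed.

Lemma w_op_ext T E : is_subring T -> E `<=` w_op T E.
Proof.
move=> hT x Ex N [[[hN NT] _ _] nNT _]; apply: prod_mod_sub Ex.
exists 1, 1; rewrite divr1; split=> //; do ?exact: subring1.
by move=> N1; apply: nNT; apply/seteqP; split=> //; apply: submod1.
Qed.

Lemma linked_w_avoids D star T Q : is_subring D -> is_semistar D star ->
  is_subring T -> D `<=` T -> is_linked D star T (w_op T) ->
  is_quasi_prime T (w_op T) Q -> avoids D star Q.
Proof.
move=> hD hstar hT DT lk [[_ _ eQ] hQ].
apply: (linked_avoids hD hstar hT DT lk (prime_submod hQ) (prime_not1 hQ)).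
  by move=> E _; apply: w_op_ext.
move=> F _ FQ F1; apply: (prime_not1 hQ); rewrite -eQ; split; last exact: subring1.
exact: w_op_mono FQ _ F1.
Qed.

Lemma valuation_w_linked D star V : is_subring D -> is_semistar D star ->
  is_valuation_ring V -> D `<=` V -> avoids D star (maxideal V) ->
  is_linked D star V (w_op V).
Proof.
move=> hD hstar hvV DV avV F hF FD /(fg_star1 hD hstar hF FD) F1.
have [hV _] := hvV.
have /existsNP[a /not_implyP[Fa /maxideal_inv[a0 Va]]] := avV F hF FD F1.
congr w_op; apply/seteqP; split.
  by apply: prod_mod_min => [|x /FD/DV//]; apply: submod_subring.
apply: submod1 => //; first exact: prod_mod_submodule.
by rewrite -(mulfV a0); apply: prod_mod_mul.
Qed.

End LocalOperations.

(** * Quasi-primes of polynomial rings *)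

Section ContentOperation.
Local Open Scope classical_set_scope.
Local Open Scope ring_scope.
Variable F : fieldType.
Implicit Types (R E Q : set F) (s t : {poly F}) (S : set {poly F}).

Lemma polyfrac_quotient (x : F) p s : s != 0 ->
  polyfrac x%:P = polyfrac p / polyfrac s <-> x%:P * s = p.
Proof.
move=> s0; have fs0 : tofrac s != 0 by rewrite tofrac_eq0.
rewrite /polyfrac; split=> [E|<-]; last by rewrite tofracM mulfK.
by apply/eqP; rewrite -tofrac_eq tofracM; apply/eqP; rewrite E divfK.
Qed.

(* Gauss: the lowest coefficients of [s] and [t] outside [Q] give a coefficient
   of [s * t] outside [Q]. *)
Lemma poly_set_prime R Q s t : is_subring R -> is_prime_ideal R Q ->
  poly_set R s -> poly_set R t -> ~ poly_set Q s -> ~ poly_set Q t ->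
  ~ poly_set Q (s * t).
Proof.
move=> hR hQ Rs Rt /existsNP[i0 Qi0] /existsNP[j0 Qj0] Qst.
have hQm := prime_submod hQ.
have exmin (u : {poly F}) k0 : ~ Q u`_k0 ->
    exists k, ~ Q u`_k /\ forall l, (l < k)%N -> Q u`_l.
  move=> Qk0; have ex : exists k, `[< ~ Q u`_k >] by exists k0; apply/asboolP.
  exists (ex_minn ex); case: ex_minnP => k /asboolP Qk kmin; split=> // l lk.
  by apply: contrapT => /asboolP/kmin; rewrite leqNgt lk.
have [i [Qi imin]] := exmin _ _ Qi0; have [j [Qj jmin]] := exmin _ _ Qj0.
apply: (primeM hQ (Rs i) (Rt j) Qi Qj).
have := Qst (i + j)%N; rewrite coefM.
have ilt : (i < (i + j).+1)%N by rewrite ltnS leq_addr.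
rewrite (bigD1 (Ordinal ilt)) //= addKn => Qsum.
rewrite -[X in Q X](addrK (\sum_(k < (i + j).+1 | k != Ordinal ilt) s`_k * t`_(i + j - k))).
apply: (submodB hR hQm Qsum); apply: (submod_sum _ hQm) => k ki.
have [lt_ki|lt_ik|eq_ki] := ltngtP k i.
- by rewrite mulrC; apply: (submodM hQm) => //; apply: imin.
- apply: (submodM hQm) => //; apply: jmin; have := ltn_ord k; lia.
- by move: ki; rewrite -val_eqE /= eq_ki eqxx.
Qed.

(** This is the trace on [F] of [E[Y]_S] with denominators cleared: [x] belongs to it when some
    [x s] has all its coefficients in [E]. It avoids computing in the rational functions in [Y]. *)
Definition content_op S E : set F :=
  [set x | exists2 s, S s & forall i, E (x * s`_i)].

Variables (R : set F) (Theta : set (set F)).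
Hypotheses (hR : is_subring R) (ThetaP : forall Q, Theta Q -> is_prime_ideal R Q).

Let S := poly_set R `\` \bigcup_(Q in Theta) poly_set Q.
Let op := content_op S.

Let S1mem : S 1.
Proof.
split=> [i|[Q TQ Q1]].
  by rewrite coef1; case: (i == _); [apply: subring1|apply: subring0].
by apply: (prime_not1 (ThetaP TQ)); have := Q1 0%N; rewrite coef1.
Qed.

Let SM s t : S s -> S t -> S (s * t).
Proof.
move=> [Rs ns] [Rt nt]; split.
  by apply: (poly_setM (A := R)) => //; apply: submod_subring.
move=> [Q TQ Qst]; apply: (poly_set_prime hR (ThetaP TQ) Rs Rt _ _ Qst) => Qs.
- by apply: ns; exists Q.
- by apply: nt; exists Q.
Qed.

Lemma content_op_ext E : is_submodule R E -> E `<=` op E.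
Proof.
move=> hE x Ex; exists 1; first exact: S1mem.
by move=> i; rewrite coef1; case: (i == _); rewrite ?mulr1 ?mulr0 //; apply: submod0 hE.
Qed.

Lemma content_op_Theta Q : Theta Q -> op Q `&` R = Q.
Proof.
move=> TQ; have hQ := ThetaP TQ; apply/seteqP; split=> x.
  move=> [[s [Rs ns] Qxs] Rx]; apply: contrapT => Qx; apply: ns; exists Q => // i.
  by have [] := prime_sub_or hQ Rx (Rs i) (Qxs i).
move=> Qx; split; last exact: prime_sub hQ _ Qx.
by apply: content_op_ext Qx; apply: prime_submod.
Qed.

Lemma content_op_proper Q : Theta Q -> star_f R op Q `<` op R.
Proof.
move=> TQ; have hQ := ThetaP TQ; split.
  move=> x [G [_ GQ] [s Ss Gs]]; exists s => // i.
  exact: prime_sub hQ _ (GQ _ (Gs i)).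
have R1 : op R 1 by apply: content_op_ext; [apply: submod_subring|apply: subring1].
move=> /(_ 1 R1) [G [_ GQ] [s Ss Gs]]; apply: (prime_not1 hQ).
by rewrite -(content_op_Theta TQ); split; [exists s => // i; apply: GQ|apply: subring1].
Qed.

Lemma content_op_1 Q s : S s -> poly_set Q s -> op Q 1.
Proof. by move=> Ss Qs; exists s => // i; rewrite mul1r. Qed.

Lemma content_op_not_proper Q s : is_prime_ideal R Q -> (exists2 x, Q x & x != 0) ->
  S s -> poly_set Q s -> op R `<=` star_f R op Q.
Proof.
move=> hQ [z Qz z0] Ss Qs x [t St Rt]; have hQm := prime_submod hQ.
exists (module_span R (z :: s)).
  split; first exact: fg_span hR (mem_head _ _) z0.
  apply: span_min => // y; rewrite inE => /predU1P[->//|/(nthP 0)[i _ <-]].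
  exact: Qs.
have hG := span_submodule (z :: s) hR.
(* [t] brings [x] into [R] and [s] supplies coefficients in the finitely generated ideal; the
   product remains in [S] by Gauss' lemma. The extra generator [z] keeps that ideal nonzero. *)
exists (s * t) => [|i]; first exact: SM.
rewrite coefM mulr_sumr; apply: (submod_sum _ hG) => j _; rewrite mulrCA.
apply: (submodMr hG); first exact: Rt.
have [js|sj] := ltnP j (size s).
  by apply: mem_span => //; rewrite inE mem_nth ?orbT.
by rewrite nth_default //; apply: submod0 hG.
Qed.

End ContentOperation.

(** * The iterated operation and its quasi-primes *)

Section PolynomialRings.
Local Open Scope classical_set_scope.
Local Open Scope ring_scope.

Section OneVariable.
Variable L : fieldType.
Implicit Types (R : set L) (sigma : set L -> set L).

Lemma poly_ring_subring R : is_subring R -> is_subring (poly_ring R).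
Proof.
move=> hR; have [h1 hB hM] := poly_set_subring hR; split.
- by exists 1 => //; apply: tofrac1.
- by move=> _ _ [p hp <-] [q hq <-]; exists (p - q); [apply: hB|apply: tofracB].
- by move=> _ _ [p hp <-] [q hq <-]; exists (p * q); [apply: hM|apply: tofracM].
Qed.

Lemma sub_csts_poly_ring R : is_subring R -> R `<=` csts (poly_ring R).
Proof.
by move=> hR x Rx; exists x%:P => //; apply: poly_setC => //; apply: subring0.
Qed.

Lemma contraction_prime R Q : is_subring R -> is_prime_ideal (poly_ring R) Q ->
  is_prime_ideal R (contraction R Q).
Proof.
move=> hR hQ; have := csts_prime (poly_ring_subring hR) hQ.
by move=> /(prime_setI hR (sub_csts_poly_ring hR)); rewrite setIC.
Qed.

Lemma contraction0 R : is_subring R -> contraction R [set 0] = [set 0].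
Proof.
move=> hR; apply/seteqP; split=> x.
  by move=> [_ /eqP]; rewrite /polyfrac tofrac_eq0 polyC_eq0 => /eqP.
by move=> ->; split; [apply: subring0|rewrite /polyfrac /= polyC0 tofrac0].
Qed.

Lemma Theta1_prime R sigma Q : Theta1 R sigma Q -> is_prime_ideal (poly_ring R) Q.
Proof. by case. Qed.

Lemma Theta1_0 R sigma : is_subring R -> Theta1 R sigma [set 0].
Proof.
move=> hR; split; first by apply: prime0; apply: poly_ring_subring.
by left; apply: contraction0.
Qed.

(** The zero ideal belongs to [Theta1], so no denominator in [S1] vanishes and fractions can be
    cleared. *)
Lemma star_polyE R sigma E : is_subring R ->
  star_poly R sigma E = content_op (S1 R sigma) E.
Proof.
move=> hR; have S0 s : S1 R sigma s -> s != 0.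
  move=> [_ ns]; apply: contra_notN ns => /eqP ->.
  by exists [set 0]; [apply: Theta1_0|move=> i; rewrite coef0].
apply/seteqP; split=> x.
  move=> [p [s [Ep Ss /(polyfrac_quotient _ _ (S0 _ Ss)) xsp]]].
  by exists s => // i; have := Ep i; rewrite -xsp coefCM.
move=> [s Ss Es]; exists (x%:P * s), s; split=> //.
  by move=> i; rewrite coefCM.
by apply/(polyfrac_quotient _ _ (S0 _ Ss)).
Qed.

End OneVariable.

Section Iterated.
Variables (K : fieldType) (D : set K) (star : set K -> set K).
Hypotheses (hD : is_subring D) (hstar : is_semistar D star).

Fixpoint icst (n : nat) : K -> iter_ratfun K n :=
  match n return K -> iter_ratfun K n with
  | 0 => id
  | m.+1 => fun a => ratcst (icst m a)
  end.

Definition icsts n (Q : set (iter_ratfun K n)) : set K := [set a | Q (icst n a)].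

Lemma iter_poly_ring_subring n : is_subring (iter_poly_ring D n).
Proof. by elim: n => //= n; apply: poly_ring_subring. Qed.

Lemma icst_iter_poly_ring n : D `<=` icsts (iter_poly_ring D n).
Proof.
elim: n => //= n IH x Dx; have hR := iter_poly_ring_subring n.
exact: (sub_csts_poly_ring hR (IH x Dx)).
Qed.

Lemma icst_eq0 n a : icst n a = 0 -> a = 0.
Proof. by elim: n => //= n IH /eqP; rewrite fmorph_eq0 => /eqP/IH. Qed.

Lemma icsts_prime n (Q : set (iter_ratfun K n)) :
  is_prime_ideal (iter_poly_ring D n) Q -> is_prime_ideal D (icsts Q `&` D).
Proof.
elim: n => [|n IH] in Q * => hQ /=; first exact: prime_setI hQ.
suff -> : icsts (n := n.+1) Q `&` D =
    icsts (contraction (iter_poly_ring D n) Q) `&` D.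
  by apply: IH; apply: contraction_prime hQ; apply: iter_poly_ring_subring.
apply/seteqP; split=> x [Qx Dx]; split=> //; last by case: Qx.
by split=> //; apply: icst_iter_poly_ring.
Qed.

(** The invariant of the induction on the number of variables: the properness test in [Theta1] at
    the next level depends only on the constants from [K] in the prime. *)
Definition Theta_spec n := forall Q, is_prime_ideal (iter_poly_ring D n) Q ->
  (exists2 x, Q x & x != 0) ->
  (star_f (iter_poly_ring D n) (iter_star_poly D star n) Q `<`
     iter_star_poly D star n (iter_poly_ring D n) <-> avoids D star (icsts Q)).

Lemma Theta1_avoids n Q : Theta_spec n ->
  Theta1 (iter_poly_ring D n) (iter_star_poly D star n) Q <->
  is_prime_ideal (iter_poly_ring D n.+1) Q /\ avoids D star (icsts (n := n.+1) Q).
Proof.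
move=> hn; have hR := iter_poly_ring_subring n.
have avE : avoids D star (icsts (contraction (iter_poly_ring D n) Q)) <->
    avoids D star (icsts (n := n.+1) Q).
  split=> av F hF FD F1 FQ; apply: (av F) => // x Fx.
    by split; [apply: icst_iter_poly_ring; apply: FD|apply: FQ].
  by have [] := FQ x Fx.
split=> [[hQ hc]|[hQ avQ]]; split=> //; have hcp := contraction_prime hR hQ.
  apply/avE; case: hc => [->|].
    by apply: avoidsS (@avoids0 _ D star) => a; apply: icst_eq0.
  have [c0|] := pselect (exists2 x, contraction (iter_poly_ring D n) Q x & x != 0).
    by move=> /(hn _ hcp c0).
  move=> c0 _; apply: avoidsS (@avoids0 _ D star) => a ca; apply: contrapT => /eqP a0.
  by apply: c0; exists (icst n a) => //; apply: contra_neq a0; apply: icst_eq0.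
have [c0|c0] := pselect (exists2 x, contraction (iter_poly_ring D n) Q x & x != 0).
  by right; apply/(hn _ hcp c0)/avE.
left; apply/seteqP; split=> [x cx|x ->]; last exact: submod0 (prime_submod hcp).
by apply: contrapT => /eqP x0; apply: c0; exists x.
Qed.

Section Step.
Variable n : nat.
Hypothesis hn : Theta_spec n.
Let R := iter_poly_ring D n.
Let R1 := iter_poly_ring D n.+1.
Let sigma := iter_star_poly D star n.
Let hR : is_subring R. Proof. exact: iter_poly_ring_subring. Qed.
Let hR1 : is_subring R1. Proof. exact: iter_poly_ring_subring. Qed.
Let ThetaP := @Theta1_prime _ R sigma.

Let sigma1E : iter_star_poly D star n.+1 = content_op (S1 R sigma).
Proof. by apply/funext => E; apply: star_polyE. Qed.

(** The generators of an offending [G] inside [Q] become the coefficients of [s]. A prime of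
    [Theta1] containing them all would contain [G], although it avoids. *)
Let not_avoids_poly Q : ~ avoids D star (icsts (n := n.+1) Q) ->
  is_prime_ideal R1 Q -> exists2 s, S1 R sigma s & poly_set Q s.
Proof.
move=> navQ hQ; move: navQ.
move=> /existsNP[G /not_implyP[hG /not_implyP[GD /not_implyP[G1 /contrapT GQ]]]].
have [g defG _] := fg_spanP hD hG.
have gG a : a \in g -> G a by move=> ag; rewrite defG; apply: mem_span.
pose s := Poly (map (icst n.+1) g).
have sE (P : set (iter_ratfun K n.+1)) : P 0 -> (forall a, a \in g -> P (icst n.+1 a)) ->
    poly_set P s.
  move=> P0 Pg i; rewrite coef_Poly; have [ig|gi] := ltnP i (size g).
    by rewrite (nth_map 0) //; apply: Pg; rewrite mem_nth.
  by rewrite nth_default ?size_map.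
exists s; last first.
  by apply: sE; [apply: submod0 (prime_submod hQ)|move=> a /gG/GQ].
split.
  apply: sE; first exact: subring0 hR1.
  by move=> a /gG/GD Da; exact: (@icst_iter_poly_ring n.+1 a Da).
move=> [P /(Theta1_avoids _ hn)[hP avP] Ps]; apply: (avP G) => //.
have [[hPm _] _ _] := icsts_prime hP.
suff GP : G `<=` icsts (n := n.+1) P `&` D by move=> a /GP[].
rewrite defG; apply: span_min => // a ag; split; last exact/GD/gG.
by have := Ps (index a g); rewrite coef_Poly (nth_map 0) ?index_mem // nth_index.
Qed.

Lemma star_poly_quasi Q : is_prime_ideal R1 Q -> (exists2 x, Q x & x != 0) ->
  iter_star_poly D star n.+1 Q `&` R1 = Q <-> avoids D star (icsts (n := n.+1) Q).
Proof.
move=> hQ nzQ; rewrite sigma1E; split=> [eQ|avQ].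
  apply: contrapT => /not_avoids_poly/(_ hQ)[s Ss Qs].
  apply: (prime_not1 hQ); rewrite -eQ; split; last exact: subring1.
  exact: content_op_1 Ss Qs.
by apply: (content_op_Theta hR1 ThetaP); apply/(Theta1_avoids _ hn).
Qed.

Lemma Theta_specS : Theta_spec n.+1.
Proof.
move=> Q hQ nzQ; rewrite sigma1E; split=> [[_ npr]|avQ].
  apply: contrapT => /not_avoids_poly/(_ hQ)[s Ss Qs]; apply: npr.
  exact: (content_op_not_proper hR1 ThetaP hQ nzQ Ss Qs).
by apply: (content_op_proper hR1 ThetaP); apply/(Theta1_avoids _ hn).
Qed.

End Step.

Lemma Theta_spec0 : Theta_spec 0.
Proof.
move=> Q hQ [z Qz z0]; have hQm := prime_submod hQ; have [[_ QD] _ _] := hQ.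
have hDD : nonzero_submodules D D by apply: subring_overring.
split=> [[_ npr] F hF FD F1 FQ|avQ].
  apply: npr => x Dx; exists F => //.
  by move: F1 => /(fg_star1 hD hstar hF FD) F1; rewrite /= F1.
split=> [x [F [hF FQ]]|/(_ 1)[]].
  by apply: (star_mono hstar (fg_nonzero hF) hDD) => y /FQ/QD.
  exact: (star_ext hstar hDD (subring1 hD)).
by move=> F [hF FQ] F1; apply: (avQ F) => // y /FQ/QD.
Qed.

Lemma Theta_specP n : Theta_spec n.
Proof. by elim: n => [|n]; [apply: Theta_spec0|apply: Theta_specS]. Qed.

Hypothesis hquot : forall x : K, exists a b, [/\ D a, D b, b != 0 & x = a / b].

Lemma star_polys_quasi_primeP n Q :
  is_quasi_prime (iter_poly_ring D n) (star_polys D star n) Q <->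
  [/\ is_prime_ideal (iter_poly_ring D n) Q, exists2 x, Q x & x != 0
    & avoids D star (icsts Q)].
Proof.
case: n => [|n] in Q *; first exact: quasi_tilde_primeP.
have quasiP := fun hQ nzQ => @star_poly_quasi n (@Theta_specP n) Q hQ nzQ.
split=> [[[_ [_ nzQ] eQ] hQ]|[hQ nzQ avQ]]; split=> //.
  by have [avQ _] := quasiP hQ nzQ; apply: avQ.
split; [by case: hQ|by split=> //; apply: prime_submod|].
by have [_ eQ] := quasiP hQ nzQ; apply: eQ.
Qed.

End Iterated.
End PolynomialRings.

(** * Pulling back chains along evaluations *)

Section WitnessedChains.
Local Open Scope classical_set_scope.
Local Open Scope ring_scope.

Section OneField.
Variable L : fieldType.
Implicit Types (B R T U : set L) (Q : nat -> set L).

(* The inclusions of the chain are strict already on [B]. *)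
Definition witnessed B Q l :=
  forall i, (i < l)%N -> exists w, [/\ B w, Q i.+1 w & ~ Q i w].

Lemma witnessedS B B' Q l : B `<=` B' -> witnessed B Q l -> witnessed B' Q l.
Proof. by move=> BB hQ i /hQ[w [Bw Qw Qw']]; exists w; split=> //; apply: BB. Qed.

Lemma prime_chain_restrict R T Q l : is_subring R -> is_subring T -> R `<=` T ->
  prime_chain T Q l -> witnessed R Q l -> prime_chain R (fun i => Q i `&` R) l.
Proof.
move=> hR hT RT hQ wQ; split.
  have [-> _] := hQ; apply/seteqP; split=> [x []//|x ->].
  by split=> //; apply: subring0.
move=> i il; split; last by apply: prime_setI hR RT _; have [] := hQ.2 i il.
apply/properE_exists; split.
  by move=> x [Qx Rx]; split=> //; apply: prime_chain_mono hQ (leqnSn i) il _ Qx.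
by have [w [Rw Qw Qw']] := wQ i il; exists w => // -[].
Qed.

End OneField.

Section Evaluation.
Variable L : fieldType.
Implicit Types (R T U : set L) (Q : nat -> set L).

Definition eval_pre T t (P : set L) : set (ratfun L) :=
  @polyfrac L @` [set p | poly_set T p /\ P p.[t]].

Lemma polyfrac_inj : injective (@polyfrac L).
Proof. by move=> p q /eqP; rewrite /polyfrac tofrac_eq => /eqP. Qed.

Lemma eval_pre_polyfrac T t P p :
  eval_pre T t P (polyfrac p) <-> poly_set T p /\ P p.[t].
Proof. by split=> [[q [Tq Pq] /polyfrac_inj <-]|hp]; [|exists p]. Qed.

Lemma eval_pre_prime T t P : is_subring T -> T t -> is_prime_ideal T P ->
  is_prime_ideal (poly_ring T) (eval_pre T t P).
Proof.
move=> hT Tt hP; have hPm := prime_submod hP; have hTT : is_submodule T T.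
  exact: submod_subring.
have ev p : poly_set T p -> T p.[t].
  move=> Tp; rewrite horner_coef; apply: subring_sum => // i _.
  by apply: subringM => //; apply: subringX.
split.
- split; last by move=> _ [p [Tp _] <-]; exists p.
  split.
  + exists 0; last exact: tofrac0.
    split=> [i|]; first by rewrite coef0; apply: subring0.
    by rewrite horner0; apply: submod0 hPm.
  + move=> _ _ [p [Tp Pp] <-] [q [Tq Pq] <-]; exists (p + q); last exact: tofracD.
    split; first exact: poly_setD hTT _ _.
    by rewrite hornerD; apply: (submodD hPm).
  + move=> _ _ [p Tp <-] [q [Tq Pq] <-]; exists (p * q); last exact: tofracM.
    split; first exact: poly_setM hTT _ _.
    by rewrite hornerM; apply: (submodM hPm) => //; apply: ev.
- have -> : (1 : ratfun L) = polyfrac 1 by rewrite /polyfrac tofrac1.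
  by move=> /eval_pre_polyfrac[_]; rewrite hornerC; apply: prime_not1 hP.
- move=> _ _ [p Tp <-] [q Tq <-].
  have -> : polyfrac p * polyfrac q = polyfrac (p * q) by rewrite /polyfrac tofracM.
  move=> /eval_pre_polyfrac[_]; rewrite hornerM.
  by move=> /(prime_sub_or hP (ev p Tp) (ev q Tq)) [Pp|Pq]; [left; exists p|right; exists q].
Qed.

(* The first inclusion is witnessed by [b X - a], where [t = a / b], and the
   witness [t] is replaced by [X]. *)
Lemma eval_pre_chain R T U t a b Q l : is_subring R -> is_subring T -> R `<=` T ->
  T t -> R a -> R b -> b != 0 -> b * t = a ->
  prime_chain T Q l -> witnessed (R `|` U `|` [set t]) Q l ->
  exists Q' : nat -> set (ratfun L), [/\ prime_chain (poly_ring T) Q' l.+1,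
    witnessed (poly_ring R `|` @ratcst L @` U) Q' l.+1 & csts (Q' l.+1) = Q l].
Proof.
move=> hR hT RT Tt Ra Rb b0 bt hQ wQ; have [Q0 _] := hQ.
have pQ i : (i <= l)%N -> is_prime_ideal T (Q i) by apply: prime_chain_prime.
(* The additional prime [Q' 1] is the kernel of the evaluation, the preimage of [Q 0]. *)
pose Q' i : set (ratfun L) := if i is j.+1 then eval_pre T t (Q j) else [set 0].
have R0 := subring0 hR; have R1 := subring1 hR.
have T0 := subring0 hT; have T1 := subring1 hT.
have wQ' : witnessed (poly_ring R `|` @ratcst L @` U) Q' l.+1.
  move=> [_|i]; last first.
    rewrite ltnS => il; have [w [Bw Qw Qw']] := wQ i il.
    have Tw : T w by apply: prime_sub (pQ i.+1 il) _ Qw.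
    have cstw : eval_pre T t (Q i.+1) (ratcst w) /\ ~ eval_pre T t (Q i) (ratcst w).
      split; first by apply/eval_pre_polyfrac; rewrite hornerC; split=> //; apply: poly_setC.
      by move=> /eval_pre_polyfrac; rewrite hornerC => -[].
    case: Bw Qw Qw' cstw => [[Rw|Uw]|->] Qw Qw' [cw cw'].
    - by exists (ratcst w); split=> //; left; exists w%:P => //; apply: poly_setC.
    - by exists (ratcst w); split=> //; right; exists w.
    - exists (polyfrac 'X); split.
      + by left; exists 'X => //; apply: poly_setX.
      + by apply/eval_pre_polyfrac; rewrite hornerX; split=> //; apply: poly_setX.
      + by move=> /eval_pre_polyfrac; rewrite hornerX => -[].
  pose p := b%:P * 'X - a%:P.
  have Rp : poly_set R p.
    have [_ hB hM] := poly_set_subring hR.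
    by apply: hB; [apply: hM; [apply: poly_setC|apply: poly_setX]|apply: poly_setC].
  exists (polyfrac p); split; first by left; exists p.
    apply/eval_pre_polyfrac; split; first by move=> i; apply: RT.
    by rewrite Q0 /p !hornerE bt subrr.
  move=> /eqP; rewrite /polyfrac tofrac_eq0 => /eqP/(congr1 (fun q : {poly L} => q`_1)).
  by rewrite /p coefB coefMX !coefC /= subr0; apply/eqP.
exists Q'; split=> //.
  split=> // i il; split; last by apply: eval_pre_prime => //; apply: pQ.
  apply/properE_exists; split.
    case: i il => [|i] il x /=.
      by move=> ->; apply: submod0 (prime_submod (eval_pre_prime hT Tt (pQ 0%N _))).
    move=> [p [Tp Qp] <-]; exists p => //; split=> //.
    exact: prime_chain_mono hQ (leqnSn i) il _ Qp.
  by have [w [_ Qw Qw']] := wQ' i il; exists w.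
apply/seteqP; split=> x.
  by move=> /eval_pre_polyfrac[_]; rewrite hornerC.
move=> Qx; apply/eval_pre_polyfrac; rewrite hornerC; split=> //.
by apply: poly_setC => //; apply: prime_sub (pQ l (leqnn l)) _ Qx.
Qed.

End Evaluation.

Section IteratedEvaluation.
Variables (K : fieldType) (D T : set K).
Hypotheses (hD : is_subring D) (hT : is_subring T) (DT : D `<=` T).
Hypothesis hquot : forall x : K, exists a b, [/\ D a, D b, b != 0 & x = a / b].

Lemma icstM n (a b : K) : icst n (a * b) = icst n a * icst n b.
Proof. by elim: n => //= n ->; rewrite rmorphM. Qed.

Lemma poly_ringS (L : fieldType) (R R' : set L) : R `<=` R' -> poly_ring R `<=` poly_ring R'.
Proof. by move=> RR _ [p Rp <-]; exists p => // i; apply: RR. Qed.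

Lemma iter_poly_ringS n : iter_poly_ring D n `<=` iter_poly_ring T n.
Proof. by elim: n => //= n IH; apply: poly_ringS. Qed.

(** [U] holds the witnesses still kept as constants: the induction first moves [t] from the list to
    [U], then lets the last variable replace it. Evaluation takes place over [T], which contains the
    points; the witnesses over [D] permit the later restriction to polynomials over [D]. *)
Lemma iterated_eval_chain (s : seq K) (U : set K) (P : nat -> set K) k :
  (forall x, x \in s -> T x) -> prime_chain T P k ->
  witnessed (D `|` U `|` [set x | x \in s]) P k ->
  exists Q, [/\ prime_chain (iter_poly_ring T (size s)) Q (size s + k),
    witnessed (iter_poly_ring D (size s) `|` icst (size s) @` U) Q (size s + k)
    & icsts (Q (size s + k)%N) = P k].
Proof.
move=> Ts hP; elim: s => [|t s IH] in U Ts * => wP.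
  exists P; split=> //; apply: witnessedS wP => x [[Dx|Ux]|//]; [by left|].
  by right; exists x.
have [||Q [hQ wQ Qk]] := IH (U `|` [set t]).
- by move=> x xs; apply: Ts; rewrite inE xs orbT.
- apply: witnessedS wP => x [[Dx|Ux]|/=]; [by do 2 left|by left; right; left|].
  by rewrite inE => /predU1P[->|xs]; [left; right; right|right].
have [a [b [Da Db b0 et]]] := hquot t.
have bt : icst (size s) b * icst (size s) t = icst (size s) a.
  by rewrite -icstM et mulrC divfK.
have ib0 : icst (size s) b != 0 by apply: contra_neq b0; apply: icst_eq0.
have hRD := iter_poly_ring_subring hD (size s).
have hRT := iter_poly_ring_subring hT (size s).
have iD x : D x -> iter_poly_ring D (size s) (icst (size s) x).
  exact: icst_iter_poly_ring.
have Tt : iter_poly_ring T (size s) (icst (size s) t).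
  by apply: icst_iter_poly_ring => //; apply: Ts; rewrite mem_head.
have wQ' : witnessed (iter_poly_ring D (size s) `|` icst (size s) @` U `|`
    [set icst (size s) t]) Q (size s + k).
  apply: witnessedS wQ => x [Rx|[y [Uy|->] <-]]; [by do 2 left| |by right].
  by left; right; exists y.
have [Q' [hQ' wQ'' Qk']] := eval_pre_chain hRD hRT (@iter_poly_ringS (size s)) Tt
  (iD a Da) (iD b Db) ib0 bt hQ wQ'.
exists Q'; split=> //.
  apply: witnessedS wQ'' => x [Rx|[_ [y Uy <-] <-]]; [by left|by right; exists y].
by rewrite -Qk -Qk'.
Qed.

(* Every nonzero prime of [T] meets [D] nontrivially, so the first inclusion
   needs no element outside [D]. *)
Lemma choose_witnesses n (P : nat -> set K) k : prime_chain T P k -> (k <= n.+1)%N ->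
  exists t : n.-tuple K, (forall x, x \in t -> T x) /\
    witnessed (D `|` set0 `|` [set x | x \in t]) P k.
Proof.
move=> hP kn.
(* The tuple must have exactly [n] entries, so indices beyond the chain receive the filler [0]. *)
have /choice[f hf] : forall i, exists w, T w /\ ((i < k)%N -> P i.+1 w /\ ~ P i w).
  move=> i; case: (ltnP i k) => ik; last by exists 0; split=> //; apply: subring0.
  have [/properE_exists[_ [w Pw Pw']] hPi] := hP.2 i ik.
  by exists w; split=> //; apply: prime_sub hPi _ Pw.
exists [tuple f (nat_of_ord i).+1 | i < n]; split.
  by move=> x /mapP[i _ ->]; have [] := hf i.+1.
move=> [|i] ik; last first.
  have [_ /(_ ik)[Pf Pf']] := hf i.+1; exists (f i.+1); split=> //; right => /=.
  have lt_in : (i < n)%N by rewrite -ltnS (leq_trans ik).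
  by apply/mapP; exists (Ordinal lt_in); rewrite ?mem_enum.
have [_ /(_ ik)[Pf Pf']] := hf 0%N; have [P0 _] := hP; have [_ hP1] := hP.2 0%N ik.
have f0 : f 0%N != 0 by apply: contra_notN Pf' => /eqP ->; rewrite P0.
have [|d [Pd Dd] d0] := overring_contract_nz hquot DT (prime_submod hP1).
  by exists (f 0%N).
by exists d; split; [left; left| |rewrite P0 => /eqP; apply/negP].
Qed.

End IteratedEvaluation.

Lemma prime_chain_icsts (K : fieldType) n (W : set (iter_ratfun K n)) Q l :
  is_valuation_ring W -> prime_chain W Q l -> Q l = maxideal W ->
  exists P l', [/\ is_valuation_ring (icsts W), prime_chain (icsts W) P l',
    icsts (maxideal W) = maxideal (icsts W) & (l <= l' + n)%N].
Proof.
elim: n => [|n IH] in W Q l * => hW hQ Ql.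
  by exists Q, l; rewrite addn0.
have [P [l1 [hP Pl ll]]] := prime_chain_csts hW hQ Ql.
have [P' [l' [hV hP' em ll']]] := IH _ _ _ (csts_valuation hW) hP Pl.
exists P', l'; split=> //; last by lia.
by rewrite -em -csts_maxideal.
Qed.

End WitnessedChains.

(** * The seven dimensions *)

Section Dimensions.
Local Open Scope classical_set_scope.
Local Open Scope ring_scope.

Lemma star_chain_of (K : fieldType) (T : set K) sigma (P : nat -> set K) l :
  is_subring T -> prime_chain T P l ->
  (forall Q, is_prime_ideal T Q -> (exists2 x, Q x & x != 0) -> Q `<=` P l ->
     is_quasi_prime T sigma Q) ->
  star_chain_lengths T sigma l.
Proof.
move=> hT hP hq; exists P; split; first by case: hP.
move=> i il; have [PP hPi] := hP.2 i il; split=> //; apply: hq => //.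
  have /properE_exists[_ [x Px Px']] := PP; exists x => //.
  apply: contra_notN Px' => /eqP ->.
  exact: submod0 (prime_submod (prime_chain_prime hT hP (ltnW il))).
exact: prime_chain_mono hP il (leqnn l).
Qed.

(** A chain of length [0] ends at the zero ideal, which is no quasi-prime; this is what [av [set 0]]
    is for. *)
Lemma chain_of_star (K : fieldType) (T : set K) sigma (av : set K -> Prop) l :
  av [set 0] -> (forall Q, is_quasi_prime T sigma Q -> av Q) ->
  star_chain_lengths T sigma l -> exists2 P, prime_chain T P l & av (P l).
Proof.
move=> av0 hq [P [P0 hP]]; exists P.
  by split=> // i /hP[PP [_ hPi]].
by case: l hP => [|l] hP; [rewrite P0|have [_ /hq] := hP l (ltnSn l)].
Qed.

(** In a domain the lowest prime of a chain may be replaced by zero without changing the length. *)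
Lemma krull_chain_lengthsP (K : fieldType) (V : set K) l : is_subring V ->
  krull_chain_lengths V l <-> exists P, prime_chain V P l.
Proof.
move=> hV; split=> [[P [hP PP]]|[P hP]]; last first.
  exists P; split=> [i il|i il]; first exact: prime_chain_prime hP il.
  by have [] := hP.2 i il.
exists (fun i => if i is j.+1 then P i else [set 0]); split=> // i il.
split; last exact: hP.
have /properE_exists[PS [x Px Px']] := PP i il; apply/properE_exists.
have Pi0 j : (j <= l)%N -> P j 0 by move=> jl; apply: submod0 (prime_submod (hP j jl)).
case: i il PS Px Px' => [|i] il PS Px Px'; last by split=> //; exists x.
split; first by move=> y ->; apply: Pi0.
by exists x => // x0; apply: Px'; rewrite x0; apply: Pi0.
Qed.

Section Bounds.
Variables (K : fieldType) (D : set K) (star : set K -> set K).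
Hypotheses (hD : is_subring D) (hstar : is_semistar D star).
Hypothesis hquot : forall x : K, exists a b, [/\ D a, D b, b != 0 & x = a / b].
Implicit Types (T V : set K) (P : nat -> set K).

Let av := avoids D star.

(** The upper bounds of [d] rather than [d] itself, so that an infinite dimension is simply the
    empty set. *)
Definition valuative_bound : set nat :=
  [set m | forall V P l, is_valuation_ring V -> D `<=` V -> av (maxideal V) ->
    prime_chain V P l -> (l <= m)%N].

Lemma iterated_chain_bound n (P : nat -> set (iter_ratfun K n)) l m :
  valuative_bound m -> prime_chain (iter_poly_ring D n) P l -> av (icsts (P l)) ->
  (l <= m + n)%N.
Proof.
move=> hm hP avP; have hR := iter_poly_ring_subring hD n.
have [W [Q [hW RW hQ Ql QR]]] := prime_chain_lift hR hP.
have [P' [l' [hV hP' em ll']]] := prime_chain_icsts hW hQ Ql.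
apply: leq_trans ll' _; rewrite leq_add2r; apply: hm hV _ _ hP'.
  by move=> x /(icst_iter_poly_ring hD)/RW.
rewrite -em -Ql => F hF FD F1 FQ; apply: (avP F) => // x Fx.
rewrite /icsts /= -(QR l (leqnn l)); split; first exact: FQ.
by apply: icst_iter_poly_ring => //; apply: FD.
Qed.

Lemma overring_chain_bound T P l m : is_subring T -> D `<=` T ->
  valuative_bound m -> prime_chain T P l -> av (P l) -> (l <= m)%N.
Proof.
move=> hT DT hm hP avP.
have [W [Q [hW TW hQ Ql QT]]] := prime_chain_lift hT hP.
apply: (hm W Q l hW _ _ hQ) => [x /DT/TW//|].
rewrite -Ql => F hF FD F1 FQ; apply: (avP F) => // x Fx.
by rewrite -(QT l (leqnn l)); split; [apply: FQ|apply/DT/FD].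
Qed.

Lemma valuation_chain_avoids V P l i : is_valuation_ring V -> av (maxideal V) ->
  prime_chain V P l -> (i <= l)%N -> av (P i).
Proof.
move=> hV avV hP il; apply: avoidsS avV; apply: prime_sub_maxideal => //.
by apply: prime_chain_prime hP il; case: hV.
Qed.

Lemma is_least_attained n : is_least valuative_bound n ->
  exists V P, [/\ is_valuation_ring V, D `<=` V, av (maxideal V) & prime_chain V P n].
Proof.
case: n => [_|n [hn nmin]].
  exists setT, (fun=> [set 0]); split=> //; first by split=> // x _; left.
  by apply: avoidsS (@avoids0 _ D star) => x [//|nx]; case: nx.
have : ~ valuative_bound n by move=> /nmin; rewrite ltnn.
move=> nb; apply: contrapT => nex; apply: nb => V P l hV DV avV hP.
rewrite leqNgt; apply/negP => nl; apply: nex; exists V, P; split=> //.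
exact: prime_chainW hP nl.
Qed.

Lemma not_valuative_bound m : ~ valuative_bound m ->
  exists V P, [/\ is_valuation_ring V, D `<=` V, av (maxideal V) & prime_chain V P m.+1].
Proof.
move=> nb; apply: contrapT => nex; apply: nb => V P l hV DV avV hP.
rewrite leqNgt; apply/negP => nl; apply: nex; exists V, P; split=> //.
exact: prime_chainW hP nl.
Qed.

Lemma adjoin_chain V P m : is_valuation_ring V -> D `<=` V -> av (maxideal V) ->
  prime_chain V P m.+1 -> exists t : m.-tuple K, exists P',
    prime_chain (adjoin D [set x | x \in t]) P' m.+1 /\ av (P' m.+1).
Proof.
move=> hV DV avV hP; have [hVr _] := hV.
have [t [Vt wP]] := choose_witnesses hVr DV hquot hP (leqnn _).
exists t, (fun i => P i `&` adjoin D [set x | x \in t]); split.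
  have [hT DaT] := adjoin_overring D [set x | x \in t].
  apply: (prime_chain_restrict hT hVr _ hP); first exact: (adjoin_min hVr DV Vt).
  by apply: witnessedS wP => x [[/DaT|]|/mem_adjoin].
by apply: avoidsS (valuation_chain_avoids hV avV hP (leqnn _)) => x [].
Qed.

Lemma loc_op_chain T P l : is_subring T -> prime_chain T P l.+1 ->
  star_chain_lengths T (tilde T (loc_op T (P l.+1))) l.+1.
Proof.
move=> hT hP; have hPl := prime_chain_prime hT hP (leqnn _).
have nzP : exists2 x, P l.+1 x & x != 0.
  have [/properE_exists[_ [x Px Px']] _] := hP.2 l (ltnSn l); exists x => //.
  apply: contra_notN Px' => /eqP ->.
  exact: submod0 (prime_submod (prime_chain_prime hT hP (leqnSn l))).
apply: (star_chain_of hT hP) => Q hQ nzQ QP.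
exact: (quasi_tilde_prime_sub hT hPl (loc_op_QMax hT hPl nzP) hQ nzQ QP).
Qed.

Lemma overring_valuation V : is_valuation_ring V -> D `<=` V -> is_overring D V.
Proof. by case. Qed.

(** The bound is tested on [T = V] with localization at the top prime of a given chain; a chain of
    length [0] satisfies every bound. *)
Lemma linked_boundP m : (forall T star', is_overring D T -> is_semistar T star' ->
    is_linked D star T star' -> star_dim_le T (tilde T star') m) <-> valuative_bound m.
Proof.
split=> [h V P [//|l] hV DV avV hP|hm T star' [hT DT] hs' lk l].
  have [hVr _] := hV; have avP := valuation_chain_avoids hV avV hP (leqnn _).
  have hPl := prime_chain_prime hVr hP (leqnn _).
  have hub := h V (loc_op V (P l.+1)) (overring_valuation hV DV)
    (loc_op_semistar hVr hPl) (loc_op_linked hD hstar hVr DV hPl avP).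
  exact: hub (loc_op_chain hVr hP).
move=> /(chain_of_star (@avoids0 _ D star)) h.
have [|P hP avP] := h; last exact: overring_chain_bound hP avP.
move=> Q; apply: (linked_tilde_avoids hD hstar hT DT lk).
by move=> E; apply: (star_ext hs').
Qed.

Lemma w_linked_boundP m : (forall T, is_overring D T ->
    is_linked D star T (w_op T) -> star_dim_le T (w_op T) m) <-> valuative_bound m.
Proof.
split=> [h V P [//|l] hV DV avV hP|hm T [hT DT] lk l].
  have [hVr _] := hV.
  have hub := h V (overring_valuation hV DV) (valuation_w_linked hD hstar hV DV avV).
  apply: hub; apply: (star_chain_of hVr hP) => Q hQ nzQ _.
  have hm := maxideal_prime hV; have Qm := prime_sub_maxideal hV hQ.
  apply: (quasi_tilde_prime_sub hVr hm _ hQ nzQ Qm); apply: valuation_w_QMax hV _.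
  by have [x Qx x0] := nzQ; exists x => //; apply: Qm.
move=> /(chain_of_star (@avoids0 _ D star)) h.
have [|P hP avP] := h; last exact: overring_chain_bound hP avP.
by move=> Q; apply: linked_w_avoids.
Qed.

Lemma tilde_chain_lengths T l : is_subring T -> D `<=` T ->
  star_chain_lengths T (semistar_restr T (tilde D star)) l <->
  exists2 P, prime_chain T P l & av (P l).
Proof.
move=> hT DT; split=> [|[P hP avP]].
  apply: chain_of_star; first exact: avoids0.
  by move=> Q /(quasi_tilde_primeP hD hstar hquot _ hT DT)[].
apply: (star_chain_of hT hP) => Q hQ nzQ QP.
apply/(quasi_tilde_primeP hD hstar hquot _ hT DT); split=> //.
exact: avoidsS QP avP.
Qed.

Lemma overring_boundP m : (forall T, is_overring D T ->
    star_dim_le T (semistar_restr T (tilde D star)) m) <-> valuative_bound m.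
Proof.
split=> [h V P l hV DV avV hP|hm T [hT DT] l].
  have [hVr _] := hV; have hub := h V (overring_valuation hV DV).
  apply: hub; apply/tilde_chain_lengths => //; exists P => //.
  exact: valuation_chain_avoids hP (leqnn _).
by move=> /(tilde_chain_lengths l hT DT)[P hP avP]; apply: overring_chain_bound hP avP.
Qed.

Lemma adjoin_boundP m : (forall t : m.-tuple K,
    let T := adjoin D [set x | x \in t] in
    star_dim_le T (semistar_restr T (tilde D star)) m) <-> valuative_bound m.
Proof.
split=> [h|/overring_boundP hm t]; last by apply: hm; apply: adjoin_overring.
apply: contrapT => /not_valuative_bound[V [P [hV DV avV hP]]].
have [t [P' [hP' avP']]] := adjoin_chain hV DV avV hP.
have [hT DT] := adjoin_overring D [set x | x \in t].
have /(h t) : star_chain_lengths (adjoin D [set x | x \in t])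
    (semistar_restr (adjoin D [set x | x \in t]) (tilde D star)) m.+1.
  by apply/tilde_chain_lengths => //; exists P'.
by rewrite leEnat ltnn.
Qed.

Lemma adjoin_linked_boundP m : (forall (t : m.-tuple K) star',
    let T := adjoin D [set x | x \in t] in
    is_semistar T star' -> is_linked D star T star' ->
    star_dim_le T (tilde T star') m) <-> valuative_bound m.
Proof.
split=> [h|/linked_boundP hm t star' T]; last by apply: hm; apply: adjoin_overring.
apply: contrapT => /not_valuative_bound[V [P [hV DV avV hP]]].
have [t [P' [hP' avP']]] := adjoin_chain hV DV avV hP.
have [hT DT] := adjoin_overring D [set x | x \in t].
have hPl := prime_chain_prime hT hP' (leqnn _).
have := h t (loc_op _ (P' m.+1)) (loc_op_semistar hT hPl)
  (loc_op_linked hD hstar hT DT hPl avP') _ (loc_op_chain hT hP').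
by rewrite leEnat ltnn.
Qed.

Lemma star_dimvP n : star_dimv_eq D (tilde D star) n <-> is_least valuative_bound n.
Proof.
have tvP V := tilde_valuationP hD hstar hquot V.
split=> [[hle [V /tvP[hV DV avV] [_ hlub]]]|hn].
  split=> [W P l hW DW avW hP|m hm].
    have /hle : is_star_valuation_overring D (tilde D star) W by apply/tvP.
    by apply; apply/krull_chain_lengthsP; [case: hW|exists P].
  apply: hlub => l /krull_chain_lengthsP h; have [|P hP] := h; first by case: hV.
  exact: hm hP.
have bound W : is_star_valuation_overring D (tilde D star) W -> krull_dim_le W n.
  move=> /tvP[hW DW avW] l /krull_chain_lengthsP h.
  have [|P hP] := h; first by case: hW.
  by have [hb _] := hn; apply: hb hP.
split=> //; have [V [P [hV DV avV hP]]] := is_least_attained hn.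
have tV : is_star_valuation_overring D (tilde D star) V by apply/tvP.
exists V => //; split; first exact: bound.
move=> b; apply; apply/krull_chain_lengthsP; [by case: hV|by exists P].
Qed.

Lemma star_polys_chain_lengths n l :
  star_chain_lengths (iter_poly_ring D n) (star_polys D star n) l <->
  exists2 P, prime_chain (iter_poly_ring D n) P l & av (icsts (P l)).
Proof.
have hR := iter_poly_ring_subring hD n.
have qP := @star_polys_quasi_primeP K D star hD hstar hquot n.
split=> [|[P hP avP]].
  apply: (chain_of_star (av := fun Q => av (icsts Q))) => [|Q /qP[]//].
  by apply: avoidsS (@avoids0 _ D star) => a; apply: icst_eq0.
apply: (star_chain_of hR hP) => Q hQ nzQ QP; apply/qP; split=> //.
by apply: avoidsS avP => a; apply: QP.
Qed.

Lemma polynomial_chain V P k n : is_valuation_ring V -> D `<=` V ->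
  av (maxideal V) -> prime_chain V P k -> (k <= n.+1)%N ->
  star_chain_lengths (iter_poly_ring D n) (star_polys D star n) (n + k).
Proof.
move=> hV DV avV hP kn; have [hVr _] := hV.
have [t [Vt wP]] := choose_witnesses hVr DV hquot hP kn.
have [Q [hQ wQ Qk]] := iterated_eval_chain hD hVr DV hquot Vt hP wP.
have hRD := iter_poly_ring_subring hD n; have hRV := iter_poly_ring_subring hVr n.
rewrite size_tuple in Q hQ wQ Qk *.
apply/star_polys_chain_lengths.
exists (fun i => Q i `&` iter_poly_ring D n).
  apply: (prime_chain_restrict hRD hRV _ hQ); first exact: iter_poly_ringS.
  by apply: witnessedS wQ => x [//|[y []]].
have avP := valuation_chain_avoids hV avV hP (leqnn _).
by apply: avoidsS avP => a [Qa _]; rewrite -Qk.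
Qed.

(** A chain of length [n + 1] would give the forbidden length [2n + 1], and one of length [n]
    attains [2n]. Minimality comes from [2n <= m + n]. *)
Lemma star_polys_dimP n :
  star_dim_eq (iter_poly_ring D n) (star_polys D star n) (2 * n)%N <->
  is_least valuative_bound n.
Proof.
have upper m l : valuative_bound m ->
    star_chain_lengths (iter_poly_ring D n) (star_polys D star n) l -> (l <= m + n)%N.
  by move=> hm /star_polys_chain_lengths[P hP avP]; apply: iterated_chain_bound hP avP.
split=> [[hub hlub]|hn].
  split=> [|m hm].
    apply: contrapT => /not_valuative_bound[V [P [hV DV avV hP]]].
    have /hub := polynomial_chain hV DV avV hP (leqnn _).
    by rewrite leEnat; lia.
  have : (2 * n <= m + n)%N by apply: hlub => l; apply: upper.
  by lia.
have [V [P [hV DV avV hP]]] := is_least_attained hn.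
split=> [l|b].
  by have [hb _] := hn; move=> /(upper n l hb); rewrite leEnat; lia.
by apply; rewrite mul2n -addnn; apply: polynomial_chain hP (leqnSn n).
Qed.

End Bounds.

End Dimensions.

Local Open Scope classical_set_scope.

Theorem theorem4p5 (K : fieldType) (D : set K) (star : set K -> set K) (n : nat)
    (hD : is_domain_with_quotient_field D) (hstar : is_semistar D star) :
  [<->
    is_least [set m | forall (T : set K) (star' : set K -> set K),
      is_overring D T -> is_semistar T star' -> is_linked D star T star' ->
      star_dim_le T (tilde T star') m] n;
    is_least [set m | forall T : set K,
      is_overring D T -> is_linked D star T (w_op T) ->
      star_dim_le T (w_op T) m] n;
    is_least [set m | forall T : set K,
      is_overring D T ->
      star_dim_le T (semistar_restr T (tilde D star)) m] n;
    star_dimv_eq D (tilde D star) n;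
    is_least [set m | forall t : m.-tuple K,
      let T := adjoin D [set x | x \in t] in
      star_dim_le T (semistar_restr T (tilde D star)) m] n;
    is_least [set m | forall (t : m.-tuple K) (star' : set K -> set K),
      let T := adjoin D [set x | x \in t] in
      is_semistar T star' -> is_linked D star T star' ->
      star_dim_le T (tilde T star') m] n;
    star_dim_eq (iter_poly_ring D n) (star_polys D star n) (2 * n)].
Proof.
have [hDr hquot] := hD; pose A := valuative_bound D star.
have setE (B : set nat) : (forall m, B m <-> A m) -> B = A.
  by move=> BA; apply/seteqP; split=> m /BA.
rewrite (setE _ (linked_boundP hDr hstar)) (setE _ (w_linked_boundP hDr hstar)).
rewrite (setE _ (overring_boundP hDr hstar hquot)).
rewrite (setE _ (adjoin_boundP hDr hstar hquot)).
rewrite (setE _ (adjoin_linked_boundP hDr hstar hquot)).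
have dimv := star_dimvP hDr hstar hquot n.
have dimp := star_polys_dimP hDr hstar hquot n.
by tfae=> //; tauto.
Qed.
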